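(* Let $d=3$. There is exactly one local-unitary (LU) equivalence class of AME$(4,3)$ states; equivalently, there is exactly one LU-equivalence class of 2-unitary matrices of size $9$. That is, 2-unitary matrices $U\in\mathcal{U}(9)$ (acting on $\mathbb{C}^3\otimes\mathbb{C}^3$) exist, and for any two 2-unitary matrices $U,U'\in\mathcal{U}(9)$ there exist $3\times 3$ unitaries $u_1,u_2,v_1,v_2$ with $U'=(u_1\otimes u_2)\,U\,(v_1\otimes v_2)$; likewise AME$(4,3)$ states exist, and any two AME$(4,3)$ states $|\psi_1\rangle,|\psi_2\rangle$ satisfy $|\psi_2\rangle=(w_1\otimes w_2\otimes w_3\otimes w_4)|\psi_1\rangle$ for some $3\times 3$ unitaries $w_1,\dots,w_4$.
   Context: An AME$(4,d)$ (absolutely maximally entangled) state is a pure state $|\psi\rangle\in(\mathbb{C}^d)^{\otimes 4}$ such that the reduced density matrix of every subset of at most two of the four parties is maximally mixed. Two four-party states are LU-equivalent if one is obtained from the other by applying a tensor product $w_1\otimes w_2\otimes w_3\otimes w_4$ of single-qudit unitaries. For a matrix $U$ on $\mathbb{C}^d\otimes\mathbb{C}^d$ with entries $\langle i\alpha|U|j\beta\rangle$ in the computational product basis, its realignment $U^R$ is defined by $\langle ij|U^R|\alpha\beta\rangle=\langle i\alpha|U|j\beta\rangle$ and its partial transpose $U^\Gamma$ by $\langle i\beta|U^\Gamma|j\alpha\rangle=\langle i\alpha|U|j\beta\rangle$. $U$ is 2-unitary if $U$, $U^R$ and $U^\Gamma$ are all unitary. Two matrices $U,U'$ of size $d^2$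 are LU-equivalent if $U'=(u_1\otimes u_2)U(v_1\otimes v_2)$ for some $d\times d$ unitaries $u_1,u_2,v_1,v_2$. A unitary $U$ of size $d^2$ defines the four-party state $|\Psi_U\rangle=\frac1d\sum_{i,\alpha,j,\beta}\langle i\alpha|U|j\beta\rangle\,|i\alpha j\beta\rangle$, which is AME$(4,d)$ when $U$ is 2-unitary. *)

(* Defs.v *)
From HB Require Import structures.
From mathcomp Require Import all_boot all_order all_algebra.
From mathcomp Require Import reals.
From mathcomp.real_closed Require Export complex mxtens.

Set Implicit Arguments.
Unset Strict Implicit.
Unset Printing Implicit Defensive.

Import Order.TTheory GRing.Theory Num.Theory.
Local Open Scope ring_scope.

Section AME.
Variable C : numClosedFieldType.
Variable d : nat.

(* product-basis index |i alpha> of C^d (x) C^d, i.e. i*d + alpha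
   (the same convention as the Kronecker product tensmx, notation *t) *)
Definition pidx (i a : 'I_d) : 'I_(d * d) := mxtens_index (i, a).
Definition unpidx (k : 'I_(d * d)) : 'I_d * 'I_d := mxtens_unindex k.

Definition adjmx n (M : 'M[C]_n) : 'M[C]_n := (map_mx Num.conj M)^T.
Definition unitarymx n (M : 'M[C]_n) : Prop := M *m adjmx M = 1%:M.

Definition realign (U : 'M[C]_(d * d)) : 'M[C]_(d * d) :=
  \matrix_(r, c) U (pidx (unpidx r).1 (unpidx c).1) (pidx (unpidx r).2 (unpidx c).2).

Definition ptrans (U : 'M[C]_(d * d)) : 'M[C]_(d * d) :=
  \matrix_(r, c) U (pidx (unpidx r).1 (unpidx c).2) (pidx (unpidx c).1 (unpidx r).2).

Definition two_unitary (U : 'M[C]_(d * d)) : Prop :=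
  [/\ unitarymx U, unitarymx (realign U) & unitarymx (ptrans U)].

Definition LU_equiv_mx (U U' : 'M[C]_(d * d)) : Prop :=
  exists u1 u2 v1 v2 : 'M[C]_d,
    [/\ unitarymx u1, unitarymx u2, unitarymx v1, unitarymx v2 &
        U' = (u1 *t u2) *m U *m (v1 *t v2)].

(* four-qudit states: amplitude functions on basis configurations
   x : 'I_4 -> 'I_d  (x k = local basis index of party k) *)
Definition cfg := {ffun 'I_4 -> 'I_d}.

Definition glue (S : {set 'I_4}) (x z : cfg) : cfg :=
  [ffun k => if k \in S then x k else z k].

(* reduced density matrix of psi on the parties in S:
   rho_S(x_S, y_S) = sum over configurations z of the complement of S of
   psi(x_S z) * conj(psi(y_S z)); only the values of x, y on S matter.
   The sum over the complement is realized by summing over the full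
   configurations z that agree with x on S (then glue S x z = z). *)
Definition rdm (psi : cfg -> C) (S : {set 'I_4}) (x y : cfg) : C :=
  \sum_(z : cfg | [forall k in S, z k == x k]) psi z * Num.conj (psi (glue S y z)).

Definition max_mixed (psi : cfg -> C) (S : {set 'I_4}) : Prop :=
  forall x y : cfg, rdm psi S x y =
    (if [forall k in S, x k == y k] then (d%:R ^+ #|S|)^-1 else 0).

(* AME(4,d): every reduction to at most two parties is maximally mixed
   (the case S = set0 is the normalization <psi|psi> = 1 of a pure state) *)
Definition AME4 (psi : cfg -> C) : Prop :=
  forall S : {set 'I_4}, (#|S| <= 2)%N -> max_mixed psi S.

Definition LU_equiv_state (psi1 psi2 : cfg -> C) : Prop :=
  exists w : 'I_4 -> 'M[C]_d, (forall k, unitarymx (w k)) /\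
    forall x : cfg, psi2 x = \sum_(y : cfg) (\prod_(k < 4) w k (x k) (y k)) * psi1 y.

End AME.

(* Main.v *)
Require Import Defs.
From HB Require Import structures.
From mathcomp Require Import all_boot all_order all_algebra.
From mathcomp Require Import reals spectral.
From mathcomp.real_closed Require Import complex mxtens.
From mathcomp Require Import ring.

(* View a 2-unitary U as a tensor T with four 3-dimensional legs, all of whose
   balanced flattenings are unitary. Antisymmetrizing two copies of T in all
   four legs gives a vector of norm 1 - 4/3 + 6/9 - 4/3 + 1 = 0, and the
   resulting linear relation between swapped copies of T says that the
   three-leg reductions F_a, G_a of T (as matrices, a running over operators
   on the shared leg) satisfy F_a G_b = F_b G_a. Restricted to a top singular
   space of one of these matrices, that family becomes simultaneously
   diagonalizable, and a common eigenvector is a traceless operator N with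
   U (1 (x) N) U^* = Y (x) M a product. Partial traces force N, Y, M to be
   multiples of unitaries with spectrum the cube roots of unity, so in suitable
   local bases U|kl> only involves the |ij> with l = i + j mod 3. The remaining
   orthogonality relations in dimension 3 leave a single support
   {k = i - j, l = i + j}, and the nine phases are products of functions of i,
   j, k and l, hence can be absorbed by diagonal unitaries. *)

Set Implicit Arguments.
Unset Strict Implicit.
Unset Printing Implicit Defensive.

Import Order.TTheory GRing.Theory Num.Theory.
Local Open Scope ring_scope.

(** * Matrix families with F_a G_b = F_b G_a *)

Section ProductVector.
Local Open Scope sesquilinear_scope.
Variable C : numClosedFieldType.

(** Dimension 3 enters through the norm of the antisymmetrization: for local dimension d the same
    sum of purities is 1 - 4/d + 6/d^2 - 4/d + 1 = 2(d - 1)(d - 3)/d^2, so the linear relation is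
    special to d = 3. (At d = 2 the value is negative, which excludes such tensors.) The obstacle is
    that F_a G_b = F_b G_a is not commutation: the two families act between different spaces, and
    their members need be neither normal nor invertible. The missing rigidity comes from the
    normalizations of both families, whose sums of F_a F_a^* and of G_a G_a^* are the same scalar
    matrix: a vector attaining the largest singular value saturates an inequality term by term, and
    on the space of such vectors the products F_{a0}^* F_a do commute. The index a0 = (0, 1) is
    off-diagonal so that every operator in the row space of F_{a0} is traceless; otherwise the
    common eigenvector could be the identity, whose image is a product for trivial reasons. *)

Lemma ex_max_nneg n (d : 'I_n.+1 -> C) :
  (forall i, 0 <= d i) -> exists i, forall j, d j <= d i.
Proof.
elim: n d => [|n IHn] d d0; first by exists ord0 => j; rewrite ord1.
have [i di] := IHn (fun j => d (lift ord0 j)) (fun j => d0 _).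
have /orP[le0|le0] := ger_leVge (d0 ord0) (d0 (lift ord0 i)).
  by exists (lift ord0 i) => j; case: (unliftP ord0 j) => [k|] ->.
exists ord0 => j; case: (unliftP ord0 j) => [k|] -> //.
exact: le_trans (di k) le0.
Qed.

(** The equality case is bundled with the bound: extremal vectors will be recognized as eigenvectors
    because they saturate it. *)
Definition form_le n (H : 'M[C]_n) (s : C) : Prop :=
  forall x : 'rV[C]_n, 0 <= (x *m (s%:M - H) *m x^t*) 0 0 /\
    ((x *m (s%:M - H) *m x^t*) 0 0 = 0 -> x *m H = s *: x).

Lemma rowform_diag n (x : 'rV[C]_n) (d : 'rV[C]_n) :
  (x *m diag_mx d *m x^t*) 0 0 = \sum_i d 0 i * `|x 0 i| ^+ 2.
Proof.
rewrite mxE; apply: eq_bigr => i _; rewrite mul_mx_diag !mxE normCK.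
by rewrite mulrAC mulrC mulrA.
Qed.

(** Spectral theorem for [M M^*]. The bound covers every [s'] above the top eigenvalue because
    several matrices are later compared with the largest of their top eigenvalues. *)
Lemma top_eigenvector n (M : 'M[C]_n) : (0 < n)%N ->
  exists s, [/\ 0 <= s, exists2 v : 'rV[C]_n, v != 0 & v *m (M *m M^t*) = s *: v
    & forall s', s <= s' -> form_le (M *m M^t*) s'].
Proof.
case: n M => // n M _; set H := M *m _.
have Hh : H \is hermsymmx.
  by apply/is_hermitianmxP; rewrite expr0 scale1r /H trmx_mul map_mxM trmxCK.
have /orthomx_spectralP := hermitian_normalmx Hh.
have PU := spectral_unitarymx H; set P := spectralmx H in PU *.
set d := spectral_diag H; rewrite (invmx_unitary PU) => HE.
have PP : P *m P^t* = 1%:M by apply/unitarymxP.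
have PP' : P^t* *m P = 1%:M by apply: mulmx1C.
have PE i : row i P *m H = d 0 i *: row i P.
  rewrite HE !mulmxA -row_mul PP row1 -rowE row_diag_mx -scalemxAl.
  by rewrite -rowE.
have rn i : row i P != 0.
  apply: contraTneq isT => r0; have := congr1 (row i) PP.
  rewrite row_mul r0 mul0mx row1 => /matrixP/(_ 0 i); rewrite !mxE !eqxx.
  by move/eqP; rewrite eq_sym oner_eq0.
have d0 i : 0 <= d 0 i.
  have : 0 <= (row i P *m H *m (row i P)^t*) 0 0.
    rewrite mulmxA -mulmxA -map_mxM -trmx_mul mxE sumr_ge0 // => k _.
    by rewrite !mxE mul_conjC_ge0.
  have <- : (row i P *m H *m (row i P)^t*) 0 0 = d 0 i => //.
  rewrite PE -scalemxAl mxE; have := congr1 (fun A : 'M_ _ => A i i) PP.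
  rewrite !mxE eqxx mulr1n => e; rewrite -[RHS]mulr1 -[in RHS]e; congr (_ * _).
  by apply: eq_bigr => k _; rewrite !mxE.
have [i0 di0] := ex_max_nneg d0.
exists (d 0 i0); split => //; first by exists (row i0 P).
move=> s' ls x; set y := x *m P^t*.
have HE' : s'%:M - H = P^t* *m diag_mx (const_mx s' - d) *m P.
  rewrite linearB /= mulmxBr mulmxBl -HE; congr (_ - _).
  by rewrite diag_const_mx mul_mx_scalar -scalemxAl PP' scalemx1.
have FE : (x *m (s'%:M - H) *m x^t*) 0 0 = \sum_i (s' - d 0 i) * `|y 0 i| ^+ 2.
  have yE : y^t* = P *m x^t* by rewrite /y trmx_mul map_mxM trmxCK.
  rewrite HE' !mulmxA -/y -mulmxA -yE rowform_diag.
  by apply: eq_bigr => i _; rewrite !mxE.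
have F0 i : true -> 0 <= (s' - d 0 i) * `|y 0 i| ^+ 2.
  by move=> _; rewrite mulr_ge0 ?exprn_ge0 // subr_ge0 (le_trans (di0 i)).
rewrite FE; split; first exact: sumr_ge0.
move=> /eqP; rewrite psumr_eq0 // => /allP z.
apply/eqP; rewrite -subr_eq0 -opprB oppr_eq0 -mul_mx_scalar -mulmxBr HE'.
rewrite !mulmxA -/y; apply/eqP.
suff -> : y *m diag_mx (const_mx s' - d) = 0 by rewrite mul0mx.
apply/matrixP => a b; rewrite ord1 mul_mx_diag; move: (y) z => u z.
rewrite !mxE; apply/eqP.
have := z b; rewrite mem_index_enum => /(_ isT).
by rewrite mulf_eq0 expf_eq0 normr_eq0 /= mulf_eq0 orbC.
Qed.

Lemma rownorm_le0 n (u : 'rV[C]_n) : (u *m u^t*) 0 0 <= 0 -> u = 0.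
Proof.
have F0 l : true -> 0 <= u 0 l * (u^t*) l 0.
  by move=> _; rewrite !mxE mul_conjC_ge0.
rewrite mxE => le0; have /eqP : \sum_l u 0 l * (u^t*) l 0 = 0.
  by apply/eqP; rewrite eq_le le0 sumr_ge0.
rewrite psumr_eq0 // => /allP z; apply/rowP => l.
have := z l; rewrite mem_index_enum => /(_ isT).
by rewrite !mxE mul_conjC_eq0 => /eqP.
Qed.

(* As [B P_a Q_a0 = B P_a0 Q_a], summing the bound |B P_a Q_a0|^2 <= s |B P_a|^2
   over [a] gives an equality, so every single term is extremal. *)
Lemma sandwich_commute (A : finType) n (P Q : A -> 'M[C]_n) a0 (k s : C) :
    (forall a b, P a *m Q b = P b *m Q a) ->
    \sum_a P a *m (P a)^t* = k%:M -> \sum_a Q a *m (Q a)^t* = k%:M ->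
    form_le (Q a0 *m (Q a0)^t*) s ->
  forall B : 'rV[C]_n, B *m (P a0 *m (P a0)^t*) = s *: B ->
  forall a, B *m P a *m (Q a0 *m (Q a0)^t*) = s *: (B *m P a).
Proof.
move=> PQ PP QQ bQ B BE a.
pose q a := (B *m P a *m (s%:M - Q a0 *m (Q a0)^t*) *m (B *m P a)^t*) 0 0.
suff q0 : \sum_a q a = 0.
  have /eqP := q0; rewrite psumr_eq0 => [/allP /(_ a)|b _]; last first.
    by have [] := bQ (B *m P b).
  rewrite mem_index_enum => /(_ isT) /eqP qa.
  by have [_ ->] := bQ (B *m P a).
have BB (u : 'rV_n) (R : 'M[C]_n) : (u *m R) *m (u *m R)^t* = u *m (R *m R^t*) *m u^t*.
  by rewrite trmx_mul map_mxM !mulmxA.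
have sumB (R : A -> 'M[C]_n) : \sum_b (B *m (R b *m (R b)^t*) *m B^t*) =
    B *m (\sum_b R b *m (R b)^t*) *m B^t*.
  by rewrite mulmx_sumr mulmx_suml.
have qE b : q b = (s *: (B *m (P b *m (P b)^t*) *m B^t*)
    - (B *m P a0 *m (Q b *m (Q b)^t*) *m (B *m P a0)^t*)) 0 0.
  rewrite /q mulmxBr mulmxBl mul_mx_scalar -scalemxAl BB; congr (fun_of_matrix (_ - _) 0 0).
  by rewrite -!BB -!(mulmxA B) PQ.
under eq_bigr do rewrite qE.
rewrite -summxE sumrB -scaler_sumr sumB PP -mulmx_suml -mulmx_sumr QQ.
rewrite !mul_mx_scalar -!scalemxAl BB BE -scalemxAl.
by rewrite !scalerA mulrC subrr mxE.
Qed.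

(** Commutation is only known on [W], so the family is restricted to a basis of [W], where it
    genuinely commutes and has a common eigenvector. *)
Lemma common_eigenvector_stable (A : finType) n (N : A -> 'M[C]_n)
    (W : 'M[C]_n) :
  W != 0 -> (forall a, stablemx W (N a)) ->
  (forall a b, W *m (N a *m N b) = W *m (N b *m N a)) ->
  exists2 x : 'rV[C]_n, x != 0 & (x <= W)%MS /\ forall a, exists m, x *m N a = m *: x.
Proof.
move=> W0 WN Wc; have sB := stablemx_row_base W.
have r0 : (0 < \rank W)%N by rewrite lt0n mxrank_eq0.
have [|v v0 /allP vP] := @common_eigenvector C _ [seq conjmx (row_base W) (N a) | a <- enum A] r0.
  move=> _ _ /mapP[a _ ->] /mapP[b _ ->].
  rewrite /comm_mx -!conjmxM ?inE ?sB //.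
  have /submxP[D DE] : (row_base W <= W)%MS by rewrite eq_row_base.
  by rewrite /conjmx DE -!(mulmxA D) Wc.
exists (v *m row_base W).
  by rewrite mulmx_free_eq0 ?row_base_free.
split=> [|a]; first by rewrite mulmx_sub // eq_row_base.
have := vP _ (map_f (fun a => conjmx (row_base W) (N a)) (mem_enum A a)).
by rewrite stablemx_restrict // => /eigenvectorP[m /eigenspaceP ->]; exists m.
Qed.

(** Let [W] be the eigenspace of [Q_a0 Q_a0^*] at the top value [s], and [N_a = P_a0^* P_a]. On [W]
    the exchange relation gives [x N_a Q_a0 = s x Q_a], and [Q_a0] is injective there, so a second
    exchange makes the [N_a] commute. For a common eigenvector [x], every [x Q_a] is a multiple of
    [x Q_a0]. *)
Lemma product_vector (A : finType) n (P Q : A -> 'M[C]_n) a0 (k : C) :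
    (forall a b, P a *m Q b = P b *m Q a) ->
    \sum_a P a *m (P a)^t* = k%:M -> \sum_a Q a *m (Q a)^t* = k%:M ->
    \sum_a (P a)^t* *m P a = k%:M -> \sum_a (Q a)^t* *m Q a = k%:M ->
    P a0 != 0 ->
  exists (x y : 'rV[C]_n) (m : A -> C), [/\ x != 0, (x <= P a0)%MS &
    forall a, x *m Q a = m a *: y].
Proof.
move=> PQ PP QQ PP' QQ' Pn0.
have n0 : (0 < n)%N.
  by case: n P Q PQ PP QQ PP' QQ' Pn0 => // P ? ? ? ? ? ?; rewrite flatmx0 eqxx.
have PQ' a b : (Q a)^t* *m (P b)^t* = (Q b)^t* *m (P a)^t*.
  by rewrite -!map_mxM -!trmx_mul PQ.
have PPt : \sum_a (P a)^t* *m (P a)^t*^t* = k%:M.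
  by rewrite -PP'; apply: eq_bigr => a _; rewrite trmxCK.
have QQt : \sum_a (Q a)^t* *m (Q a)^t*^t* = k%:M.
  by rewrite -QQ'; apply: eq_bigr => a _; rewrite trmxCK.
(* A single [s] bounding all four matrices lets [sandwich_commute] run both from [P] to [Q] and, for
   the adjoints, from [Q] to [P]; it is attained by at least one of them. *)
pose M (i : 'I_4) := [:: P a0; Q a0; (P a0)^t*; (Q a0)^t*]`_i.
have [s [s0 bnd [i [v v0 vE]]]] : exists s, [/\ 0 <= s,
    forall i, form_le (M i *m (M i)^t*) s &
    exists i, exists2 v : 'rV[C]_n, v != 0 & v *m (M i *m (M i)^t*) = s *: v].
  have /fin_all_exists[d dP] : forall i, exists s, [/\ 0 <= s,
      exists2 v : 'rV[C]_n, v != 0 & v *m (M i *m (M i)^t*) = s *: v &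
      forall s', s <= s' -> form_le (M i *m (M i)^t*) s'].
    by move=> i; apply: top_eigenvector.
  have [|i di] := @ex_max_nneg 3 d; first by move=> i; have [] := dP i.
  exists (d i); have [h1 h2 _] := dP i; split=> // [j|]; last by exists i.
  by have [_ _] := dP j; apply.
have bP := bnd (inord 0); have bQ := bnd (inord 1).
have bPt := bnd (inord 2); have bQt := bnd (inord 3).
rewrite /M !inordK //= ?trmxCK in bP bQ bPt bQt.
have SPQ := sandwich_commute PQ PP QQ bQ.
have := @sandwich_commute A n (fun a => (Q a)^t*) (fun a => (P a)^t*) a0 k s PQ' QQt PPt.
rewrite !trmxCK => /(_ bPt) SQP {PP QQ PPt QQt PP' QQ' PQ'}.
have sn0 : s != 0.
  apply: contraNneq Pn0 => sz; apply/eqP/row_matrixP => j; rewrite row0 rowE.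
  set w := delta_mx _ _.
  have [le0 _] := bP w; move: le0.
  rewrite sz raddf0 sub0r mulmxN mulNmx.
  rewrite [X in 0 <= X]mxE oppr_ge0 => le0; apply: rownorm_le0.
  by move: le0; rewrite trmx_mul map_mxM !mulmxA.
pose W := eigenspace (Q a0 *m (Q a0)^t*) s.
have inW (x : 'rV_n) : (x <= W)%MS = (x *m (Q a0 *m (Q a0)^t*) == s *: x).
  by apply/eigenspaceP/eqP.
(* The adjoint sandwich, applied to [x *m Q a0], places [W] inside the [s]-eigenspace of
   [P_a0^* P_a0]. *)
have WP (x : 'rV_n) : (x <= W)%MS -> x *m ((P a0)^t* *m P a0) = s *: x.
  rewrite inW => /eqP xW; have := SQP (x *m Q a0).
  rewrite mulmxA -(mulmxA x) xW -scalemxAl => /(_ erefl a0).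
  rewrite -(mulmxA x) xW -scalemxAl => /(scalerI sn0) //.
pose N a := (P a0)^t* *m P a.
have NW (x : 'rV_n) a : (x <= W)%MS -> (x *m N a <= W)%MS.
  move=> xW; rewrite inW /N (mulmxA x); apply/eqP/SPQ.
  by rewrite mulmxA -(mulmxA x) WP // -scalemxAl.
have NQ (x : 'rV_n) a : (x <= W)%MS -> x *m N a *m Q a0 = s *: (x *m Q a).
  by move=> xW; rewrite /N -!mulmxA PQ !mulmxA -(mulmxA x) WP // -scalemxAl.
have injQ (x y : 'rV_n) : (x <= W)%MS -> (y <= W)%MS -> x *m Q a0 = y *m Q a0 -> x = y.
  rewrite !inW !mulmxA => /eqP xW /eqP yW e; move: xW; rewrite e yW.
  by move/(scalerI sn0).
have W0 : W != 0.
  suff [x x0 xW] : exists2 x : 'rV_n, x != 0 & (x <= W)%MS.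
    by apply: contraNneq x0 => Wz; move: xW; rewrite Wz submx0.
  have nz (R S : 'M[C]_n) (u : 'rV_n) : u != 0 -> u *m (R *m S) = s *: u -> u *m R != 0.
    move=> u0 uE; apply: contraNneq u0 => uR; move: uE; rewrite mulmxA uR mul0mx.
    by move/esym/eqP; rewrite scaler_eq0 (negPf sn0).
  (* Whichever matrix attains [s], its eigenvector is carried into [W]: through [P a0] by the
     sandwich, through an adjoint by intertwining [R S] with [S R]. *)
  case: i vE => -[|[|[|[|//]]]] ? /=; rewrite /M /= ?trmxCK => vE.
  - exists (v *m P a0); first exact: nz vE.
    by rewrite inW; apply/eqP/SPQ.
  - by exists v; rewrite ?inW ?vE.
  - have v1 := nz _ _ _ v0 vE.
    have v1E : v *m (P a0)^t* *m (P a0 *m (P a0)^t*) = s *: (v *m (P a0)^t*).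
      by rewrite mulmxA -(mulmxA v) vE -scalemxAl.
    exists (v *m (P a0)^t* *m P a0); first exact: nz v1E.
    by rewrite inW; apply/eqP/SPQ.
  - exists (v *m (Q a0)^t*); first exact: nz vE.
    by rewrite inW mulmxA -(mulmxA v) vE -scalemxAl.
have NN (x : 'rV_n) a b : (x <= W)%MS -> x *m N a *m N b = x *m N b *m N a.
  move=> xW; apply: injQ; rewrite ?NW // !NQ ?NW // /N; congr (_ *: _).
  by rewrite -!mulmxA PQ.
clearbody N W.
have rW j : (row j W <= W)%MS by exact: row_sub.
have [|a b|x x0 [xW xN]] := @common_eigenvector_stable A n N W W0.
- by move=> a; apply/row_subP => j; rewrite (row_mul _ W) NW.
- apply/row_matrixP => j; rewrite !(row_mul _ W) !(mulmxA (row j W)).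
  exact: NN.
- have /fin_all_exists[m mP] := xN.
  exists x, (x *m Q a0), (fun a => s^-1 * m a); split=> //.
    have := WP _ xW; rewrite mulmxA => e.
    by rewrite -(scale1r x) -(mulVf sn0) -scalerA -e scalemx_sub ?submxMl.
  by move=> a; rewrite -scalerA scalemxAl -mP NQ // scalerA mulVf ?scale1r.
Qed.

End ProductVector.

(** * Two copies of a perfect tensor *)

Section BigHelpers.
Variables (R : comPzRingType).

Lemma sum_delta (I : finType) (a : I) (F : I -> R) :
  \sum_i (i == a)%:R * F i = F a.
Proof.
rewrite (bigD1 a) //= eqxx mul1r big1 ?addr0 // => i /negPf ->.
by rewrite mul0r.
Qed.

Lemma sum_delta' (I : finType) (a : I) (F : I -> R) :
  \sum_i (a == i)%:R * F i = F a.
Proof. by under eq_bigr do rewrite eq_sym; rewrite sum_delta. Qed.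

Lemma mul_sum2 (I J K L : finType) (f : I -> J -> R) (g : K -> L -> R) :
  \sum_i \sum_j \sum_k \sum_l f i j * g k l =
  (\sum_i \sum_j f i j) * (\sum_k \sum_l g k l).
Proof.
rewrite mulr_suml; apply: eq_bigr => i _.
rewrite mulr_suml; apply: eq_bigr => j _.
by rewrite mulr_sumr; apply: eq_bigr => k _; rewrite mulr_sumr.
Qed.

Lemma exchange_big22 (I J K L : finType) (F : I -> J -> K -> L -> R) :
  \sum_i \sum_j \sum_k \sum_l F i j k l = \sum_k \sum_l \sum_i \sum_j F i j k l.
Proof.
under eq_bigr => i _ do rewrite exchange_big /=.
rewrite exchange_big /=; apply: eq_bigr => k _.
under eq_bigr => i _ do rewrite exchange_big /=.
by rewrite exchange_big.
Qed.

Lemma sum_pair (I J : finType) (F : I * J -> R) :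
  \sum_p F p = \sum_i \sum_j F (i, j).
Proof. by rewrite pair_bigA; apply: eq_bigr => -[]. Qed.

Lemma sum_pair_mul2 (J K : finType) (f g : J -> K -> R) :
  \sum_(q : J * J) \sum_(r : K * K) f q.1 r.1 * g q.2 r.2 =
  (\sum_j \sum_k f j k) * (\sum_j \sum_k g j k).
Proof.
rewrite -mul_sum2 sum_pair; apply: eq_bigr => j _; rewrite exchange_big /= sum_pair.
by apply: eq_bigr => k _; rewrite exchange_big.
Qed.

Lemma sum_pair_mul3 (J K L : finType) (f g : J -> K -> L -> R) :
  \sum_(q : J * J) \sum_(r : K * K) \sum_(s : L * L)
     f q.1 r.1 s.1 * g q.2 r.2 s.2 =
  (\sum_j \sum_k \sum_l f j k l) * (\sum_j \sum_k \sum_l g j k l).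
Proof.
pose f' (j : J) (kl : K * L) := f j kl.1 kl.2.
pose g' (j : J) (kl : K * L) := g j kl.1 kl.2.
transitivity (\sum_(q : J * J) \sum_(r : (K * L) * (K * L)) f' q.1 r.1 * g' q.2 r.2).
  apply: eq_bigr => q _; rewrite pair_bigA.
  rewrite (reindex (fun r : (K * L) * (K * L) => ((r.1.1, r.2.1), (r.1.2, r.2.2)))) //=.
  by exists (fun r => ((r.1.1, r.2.1), (r.1.2, r.2.2))) => -[[? ?] [? ?]].
rewrite sum_pair_mul2; congr (_ * _); apply: eq_bigr => j _; rewrite sum_pair //.
Qed.

End BigHelpers.

Section PerfectTensor.
Variable C : numClosedFieldType.
Local Notation I := 'I_3.
Definition tensor4 := I -> I -> I -> I -> C.

Record perfect (T : tensor4) : Prop := Perfect {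
  sum12 : forall k l k' l', \sum_i \sum_j T i j k l * (T i j k' l')^* =
    (k == k')%:R * (l == l')%:R;
  sum13 : forall j l j' l', \sum_i \sum_k T i j k l * (T i j' k l')^* =
    (j == j')%:R * (l == l')%:R;
  sum14 : forall j k j' k', \sum_i \sum_l T i j k l * (T i j' k' l)^* =
    (j == j')%:R * (k == k')%:R;
  sum23 : forall i l i' l', \sum_j \sum_k T i j k l * (T i' j k l')^* =
    (i == i')%:R * (l == l')%:R;
  sum24 : forall i k i' k', \sum_j \sum_l T i j k l * (T i' j k' l)^* =
    (i == i')%:R * (k == k')%:R;
  sum34 : forall i j i' j', \sum_k \sum_l T i j k l * (T i' j' k l)^* =
    (i == i')%:R * (j == j')%:R }.

(** * Vanishing of the antisymmetrized double copy, and the exchange relation it implies *)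

Section Identity.
Variables (T : tensor4) (HT : perfect T).

Local Notation P := (I * I)%type.
Local Notation sw p := (p.2, p.1).

Lemma sum_swap (F : P -> C) : \sum_p F (sw p) = \sum_p F p.
Proof.
by rewrite [RHS](reindex (fun p : P => sw p)) //; exists (fun p : P => sw p) => -[].
Qed.

(** Components of [T (x) T]: each pair holds the indices of one leg in the two copies, so [sw] on a
    pair exchanges the copies in that leg alone. *)
Definition two_copies (U : tensor4) (p q r s : P) : C :=
  U p.1 q.1 r.1 s.1 * U p.2 q.2 r.2 s.2.

(** Swap trick: exchanging one leg between the copies yields the trace of the square of that leg's
    reduced operator, here [k] times the identity. The tensor is arbitrary so that the other legs
    follow by permuting its arguments. *)
Lemma overlap_swap1 (U : tensor4) (k : C) :
  (forall i i', \sum_j \sum_k \sum_l U i j k l * (U i' j k l)^* = k * (i == i')%:R) ->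
  \sum_p \sum_q \sum_r \sum_s
    two_copies U (sw p) q r s * (two_copies U p q r s)^* = 3%:R * k ^+ 2.
Proof.
move=> Uk.
transitivity (\sum_(p : P) (k * (p.2 == p.1)%:R) * (k * (p.1 == p.2)%:R)).
  apply: eq_bigr => p _; rewrite -!Uk -sum_pair_mul3.
  apply: eq_bigr => q _; apply: eq_bigr => r _; apply: eq_bigr => s _.
  by rewrite /two_copies rmorphM /=; ring.
rewrite sum_pair /=; transitivity (\sum_(i : I) k ^+ 2).
  apply: eq_bigr => i _; rewrite -[RHS](sum_delta' i (fun=> k ^+ 2)).
  by apply: eq_bigr => j _; rewrite (eq_sym j i); case: eqP => _ /=; ring.
by rewrite sumr_const card_ord mulr_natl.
Qed.

Lemma overlap_swap12 (U : tensor4) :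
  (forall i j i' j', \sum_k \sum_l U i j k l * (U i' j' k l)^* =
     (i == i')%:R * (j == j')%:R) ->
  \sum_p \sum_q \sum_r \sum_s
    two_copies U (sw p) (sw q) r s * (two_copies U p q r s)^* = 9%:R.
Proof.
move=> U1.
transitivity (\sum_(p : P) \sum_(q : P) (p.1 == p.2)%:R * (q.1 == q.2)%:R : C).
  apply: eq_bigr => p _; apply: eq_bigr => q _.
  transitivity (((p.2 == p.1)%:R * (q.2 == q.1)%:R) * ((p.1 == p.2)%:R * (q.1 == q.2)%:R) : C).
    rewrite -!U1 -sum_pair_mul2; apply: eq_bigr => r _; apply: eq_bigr => s _.
    by rewrite /two_copies rmorphM /=; ring.
  rewrite (eq_sym p.2) (eq_sym q.2).
  by case: (p.1 == p.2); case: (q.1 == q.2); rewrite /=; ring.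
have S1 : \sum_(p : P) (p.1 == p.2)%:R = 3%:R :> C.
  rewrite sum_pair /=; transitivity (\sum_(i : I) (1 : C)).
    by apply: eq_bigr => i _; rewrite -[RHS](sum_delta' i (fun=> 1)); apply: eq_bigr => j _; rewrite mulr1.
  by rewrite sumr_const card_ord.
under eq_bigr do rewrite -mulr_sumr S1.
by rewrite -mulr_suml S1 -natrM.
Qed.

(** A subset of swapped legs and its complement give the same term, so one of each pair is kept,
    with the parity of the subset as sign. *)
Definition alt_copies (p q r s : P) : C :=
  let X := two_copies T in
  X p q r s + X p q (sw r) (sw s) + X (sw p) q r (sw s) + X p (sw q) r (sw s)
  - X (sw p) q r s - X p (sw q) r s - X p q (sw r) s - X p q r (sw s).

Lemma marg1 i i' : \sum_j \sum_k \sum_l T i j k l * (T i' j k l)^* = 3%:R * (i == i')%:R.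
Proof.
under eq_bigr do rewrite (sum34 HT) eqxx mulr1.
by rewrite sumr_const card_ord mulr_natl.
Qed.
Lemma marg2 j j' : \sum_i \sum_k \sum_l T i j k l * (T i j' k l)^* = 3%:R * (j == j')%:R.
Proof.
under eq_bigr do rewrite (sum34 HT) eqxx mul1r.
by rewrite sumr_const card_ord mulr_natl.
Qed.
Lemma marg3 k k' : \sum_i \sum_j \sum_l T i j k l * (T i j k' l)^* = 3%:R * (k == k')%:R.
Proof.
under eq_bigr do rewrite (sum24 HT) eqxx mul1r.
by rewrite sumr_const card_ord mulr_natl.
Qed.
Lemma marg4 l l' : \sum_i \sum_j \sum_k T i j k l * (T i j k l')^* = 3%:R * (l == l')%:R.
Proof.
under eq_bigr do rewrite (sum23 HT) eqxx mul1r.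
by rewrite sumr_const card_ord mulr_natl.
Qed.

Local Notation ov X' := (\sum_p \sum_q \sum_r \sum_s
   (X' p q r s * (two_copies T p q r s)^*)).

(** The eight overlaps are [81 + 3 * 9 - 4 * 27]: the square of the squared norm 9, three two-leg
    purities 9, and four one-leg purities [3 * 3^2]. *)
Lemma overlap_alt : ov alt_copies = 0.
Proof.
have X1 : ov (two_copies T) = 81%:R.
  have N : \sum_i \sum_j \sum_k \sum_l T i j k l * (T i j k l)^* = 9%:R.
    under eq_bigr do rewrite marg1 eqxx mulr1.
    by rewrite sumr_const card_ord -mulrnA.
  have -> : 81%:R = 9%:R * 9%:R :> C by rewrite -natrM.
  rewrite -N [in RHS]mulr_suml sum_pair; apply: eq_bigr => i _.
  rewrite mulr_sumr; apply: eq_bigr => i' _; rewrite -sum_pair_mul3 /=.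
  apply: eq_bigr => q _; apply: eq_bigr => r _; apply: eq_bigr => s _.
  by rewrite /two_copies rmorphM /=; ring.
have X34 : ov (fun p q r s => two_copies T p q (sw r) (sw s)) = 9%:R.
  rewrite exchange_big22 -(@overlap_swap12 (fun k l i j => T i j k l)).
    do 4 (apply: eq_bigr => ? _); by rewrite /two_copies.
  by move=> *; rewrite (sum12 HT).
have X14 : ov (fun p q r s => two_copies T (sw p) q r (sw s)) = 9%:R.
  rewrite -(@overlap_swap12 (fun i l j k => T i j k l)).
    apply: eq_bigr => p _; rewrite [RHS]exchange_big /=; apply: eq_bigr => q _.
    by rewrite [RHS]exchange_big.
  by move=> *; rewrite (sum23 HT).
have X24 : ov (fun p q r s => two_copies T p (sw q) r (sw s)) = 9%:R.
  rewrite -(@overlap_swap12 (fun j l i k => T i j k l)).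
    rewrite [LHS]exchange_big /=; apply: eq_bigr => p _.
    rewrite [RHS]exchange_big /=; apply: eq_bigr => q _.
    by rewrite [RHS]exchange_big.
  by move=> *; rewrite (sum13 HT).
have Y1 : ov (fun p q r s => two_copies T (sw p) q r s) = 27%:R.
  by rewrite (overlap_swap1 marg1) -natrX -natrM.
have Y2 : ov (fun p q r s => two_copies T p (sw q) r s) = 27%:R.
  rewrite exchange_big (@overlap_swap1 (fun j i k l => T i j k l) 3%:R) //.
    by rewrite -natrX -natrM.
  exact: marg2.
have Y3 : ov (fun p q r s => two_copies T p q (sw r) s) = 27%:R.
  transitivity (3%:R * 3%:R ^+ 2 : C); last by rewrite -natrX -natrM.
  rewrite -(@overlap_swap1 (fun k i j l => T i j k l) 3%:R); last exact: marg3.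
  rewrite [RHS]exchange_big; apply: eq_bigr => p _.
  by rewrite [RHS]exchange_big.
have Y4 : ov (fun p q r s => two_copies T p q r (sw s)) = 27%:R.
  transitivity (3%:R * 3%:R ^+ 2 : C); last by rewrite -natrX -natrM.
  rewrite -(@overlap_swap1 (fun l i j k => T i j k l) 3%:R); last exact: marg4.
  rewrite [RHS]exchange_big; apply: eq_bigr => p _.
  rewrite [RHS]exchange_big; apply: eq_bigr => q _.
  by rewrite [RHS]exchange_big.
transitivity (81%:R + 9%:R + 9%:R + 9%:R - 27%:R - 27%:R - 27%:R - 27%:R : C); last by ring.
rewrite -{1}X1 -{1}X34 -{1}X14 -{1}X24 -{1}Y1 -{1}Y2 -{1}Y3 -{1}Y4.
do 4 (rewrite -!(sumrB, big_split) /=; apply: eq_bigr => ? _).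
by rewrite /alt_copies; ring.
Qed.

Lemma alt_copies_swap1 p q r s : alt_copies (sw p) q r s = - alt_copies p q r s.
Proof.
case: p q r s => [i i'] [j j'] [k k'] [l l'].
by rewrite /alt_copies /two_copies /=; ring.
Qed.

Lemma alt_copies_swap2 p q r s : alt_copies p (sw q) r s = - alt_copies p q r s.
Proof.
case: p q r s => [i i'] [j j'] [k k'] [l l'].
by rewrite /alt_copies /two_copies /=; ring.
Qed.

Lemma alt_copies_swap3 p q r s : alt_copies p q (sw r) s = - alt_copies p q r s.
Proof.
case: p q r s => [i i'] [j j'] [k k'] [l l'].
by rewrite /alt_copies /two_copies /=; ring.
Qed.

Lemma alt_copies_swap4 p q r s : alt_copies p q r (sw s) = - alt_copies p q r s.
Proof.
case: p q r s => [i i'] [j j'] [k k'] [l l'].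
by rewrite /alt_copies /two_copies /=; ring.
Qed.


(** The antisymmetrization is orthogonal to [T (x) T]. Being odd under each one-leg swap, it is also
    orthogonal to all swapped copies, hence to itself, since it is a signed sum of them. *)
Lemma alt_copies0 p q r s : alt_copies p q r s = 0.
Proof.
pose S (F : P -> P -> P -> P -> C) := \sum_p \sum_q \sum_r \sum_s F p q r s.
have S1 F : S (fun p q r s => F (sw p) q r s) = S F.
  exact: (sum_swap (fun p => \sum_q \sum_r \sum_s F p q r s)).
have S2 F : S (fun p q r s => F p (sw q) r s) = S F.
  apply: eq_bigr => a _.
  exact: (sum_swap (fun q => \sum_r \sum_s F a q r s)).
have S3 F : S (fun p q r s => F p q (sw r) s) = S F.
  apply: eq_bigr => a _; apply: eq_bigr => b _.
  exact: (sum_swap (fun r => \sum_s F a b r s)).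
have S4 F : S (fun p q r s => F p q r (sw s)) = S F.
  apply: eq_bigr => a _; apply: eq_bigr => b _; apply: eq_bigr => c _.
  exact: (sum_swap (fun s => F a b c s)).
have SE F G : (forall p q r s, F p q r s = G p q r s) -> S F = S G.
  by move=> FG; do 4 (apply: eq_bigr => ? _); rewrite FG.
have SN F : S (fun p q r s => - F p q r s) = - S F.
  by rewrite /S -sumrN; do 3 (apply: eq_bigr => ? _; rewrite -sumrN).
pose D := alt_copies; pose X := two_copies T.
pose G p q r s := D p q r s * (X p q r s)^*.
have G0 : S G = 0 by exact: overlap_alt.
have G1 : S (fun p q r s => D p q r s * (X (sw p) q r s)^*) = 0.
  rewrite -S1 -[RHS]oppr0 -G0 -SN; apply: SE => -[? ?] ? ? ?.
  by rewrite /D alt_copies_swap1 mulNr.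
have G2 : S (fun p q r s => D p q r s * (X p (sw q) r s)^*) = 0.
  rewrite -S2 -[RHS]oppr0 -G0 -SN; apply: SE => ? [? ?] ? ?.
  by rewrite /D alt_copies_swap2 mulNr.
have G3 : S (fun p q r s => D p q r s * (X p q (sw r) s)^*) = 0.
  rewrite -S3 -[RHS]oppr0 -G0 -SN; apply: SE => ? ? [? ?] ?.
  by rewrite /D alt_copies_swap3 mulNr.
have G4 : S (fun p q r s => D p q r s * (X p q r (sw s))^*) = 0.
  rewrite -S4 -[RHS]oppr0 -G0 -SN; apply: SE => ? ? ? [? ?].
  by rewrite /D alt_copies_swap4 mulNr.
have G14 : S (fun p q r s => D p q r s * (X (sw p) q r (sw s))^*) = 0.
  rewrite -S4 -[RHS]oppr0 -G1 -SN; apply: SE => ? ? ? [? ?].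
  by rewrite /D alt_copies_swap4 mulNr.
have G24 : S (fun p q r s => D p q r s * (X p (sw q) r (sw s))^*) = 0.
  rewrite -S4 -[RHS]oppr0 -G2 -SN; apply: SE => ? ? ? [? ?].
  by rewrite /D alt_copies_swap4 mulNr.
have G34 : S (fun p q r s => D p q r s * (X p q (sw r) (sw s))^*) = 0.
  rewrite -S4 -[RHS]oppr0 -G3 -SN; apply: SE => ? ? ? [? ?].
  by rewrite /D alt_copies_swap4 mulNr.
have DD : S (fun p q r s => D p q r s * (D p q r s)^*) = 0.
  transitivity (0 + 0 + 0 + 0 - 0 - 0 - 0 - 0 : C); last by ring.
  rewrite -{1}G0 -{1}G34 -{1}G14 -{1}G24 -{1}G1 -{1}G2 -{1}G3 -{1}G4 /S.
  do 4 (rewrite -!(sumrB, big_split) /=; apply: eq_bigr => ? _).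
  by rewrite /G {2}/D /alt_copies !(rmorphB, rmorphD) /=; ring.
have D0 a b c d : 0 <= D a b c d * (D a b c d)^* by exact: mul_conjC_ge0.
have DD4 a b c : 0 <= \sum_d D a b c d * (D a b c d)^* by apply: sumr_ge0.
have DD3 a b : 0 <= \sum_c \sum_d D a b c d * (D a b c d)^* by apply: sumr_ge0.
have DD2 a : 0 <= \sum_b \sum_c \sum_d D a b c d * (D a b c d)^* by apply: sumr_ge0.
have pz (F : P -> C) x : (forall y, 0 <= F y) -> \sum_y F y = 0 -> F x = 0.
  move=> F0 /eqP; rewrite psumr_eq0 // => /allP /(_ x).
  by rewrite mem_index_enum => /(_ isT) /eqP.
have := pz _ s (D0 p q r) (pz _ r (DD4 p q) (pz _ q (DD3 p) (pz _ p DD2 DD))).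
by move/eqP; rewrite mul_conjC_eq0 => /eqP.
Qed.

(* As [T (x) T] is invariant under exchanging the copies in all four legs, the
   sixteen terms of its antisymmetrization coincide in pairs. *)
Lemma swap_relation i i' j j' k k' l l' :
  T i j k' l * T i' j' k l' =
    T i j k l * T i' j' k' l' + T i j k' l' * T i' j' k l
  + T i' j k l' * T i j' k' l + T i j' k l' * T i' j k' l
  - T i' j k l * T i j' k' l' - T i j' k l * T i' j k' l'
  - T i j k l' * T i' j' k' l.
Proof.
have := alt_copies0 (i, i') (j, j') (k, k') (l, l').
by rewrite /alt_copies /two_copies /= => e;
  apply/eqP; rewrite -subr_eq0 -oppr_eq0; apply/eqP; rewrite -[RHS]e; ring.
Qed.

(** These are the families F and G of the overview, on legs 1, 3, 4 and on legs 2, 3, 4. The leg-4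
    pair [(l, l')] labels the member of the family, and the leg-3 pair [(k, k')] is the one
    contracted between them. *)
Definition reduced3 i i' k k' l l' : C := \sum_j T i j k l * (T i' j k' l')^*.
Definition reduced3' j j' k k' l l' : C := \sum_i T i j k l * (T i j' k' l')^*.

(** Regrouping the two unconjugated factors and the two conjugated ones lets [swap_relation] act on
    either pair. *)
Lemma contract_reduced3 i i' j j' l l' m m' :
  \sum_k \sum_k' reduced3 i i' k k' l l' * reduced3' j j' k' k m m' =
  \sum_J \sum_k \sum_I \sum_k' (T i J k' l * T I j k m) * ((T i' J k l')^* * (T I j' k' m')^*).
Proof.
transitivity (\sum_k \sum_k' \sum_J \sum_I (T i J k l * (T i' J k' l')^*) * (T I j k' m * (T I j' k m')^*)).
  do 2 (apply: eq_bigr => ? _); rewrite /reduced3 /reduced3' mulr_suml.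
  by apply: eq_bigr => ? _; rewrite mulr_sumr.
rewrite exchange_big22; apply: eq_bigr => J _.
rewrite [RHS]exchange_big /=; apply: eq_bigr => n _; rewrite exchange_big.
by do 2 (apply: eq_bigr => ? _) => /=; ring.
Qed.

Lemma factor4 (f : I -> I -> C) (g : I -> I -> C) (F : I -> I -> I -> I -> C) :
  (forall J k n k', F J k n k' = f J k * g n k') ->
  \sum_J \sum_k \sum_n \sum_k' F J k n k' = (\sum_J \sum_k f J k) * (\sum_n \sum_k' g n k').
Proof. by move=> E; rewrite -mul_sum2; do 4 (apply: eq_bigr => ? _); rewrite E. Qed.

Lemma factorL (f : I -> I -> I -> C) (g : I -> I -> C) c (a : I) (F : I -> I -> I -> I -> C) :
  (forall J k n k', F J k n k' = f n J k * g n k') ->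
  (forall n, \sum_J \sum_k f n J k = (n == a)%:R * c) ->
  \sum_J \sum_k \sum_n \sum_k' F J k n k' = c * \sum_k' g a k'.
Proof.
move=> E fa; rewrite exchange_big22.
transitivity (\sum_n (n == a)%:R * (c * \sum_k' g n k')); last exact: sum_delta.
apply: eq_bigr => n _; rewrite mulrA -fa mulr_sumr; apply: eq_bigr => k' _.
rewrite mulr_suml; apply: eq_bigr => J _; rewrite mulr_suml.
by apply: eq_bigr => k _; rewrite E.
Qed.

Lemma factorR (f : I -> I -> C) (g : I -> I -> I -> C) c (a : I) (F : I -> I -> I -> I -> C) :
  (forall J k n k', F J k n k' = f J k * g J n k') ->
  (forall J, \sum_n \sum_k' g J n k' = (J == a)%:R * c) ->
  \sum_J \sum_k \sum_n \sum_k' F J k n k' = c * \sum_k f a k.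
Proof.
move=> E ga; transitivity (\sum_J (J == a)%:R * (c * \sum_k f J k)); last exact: sum_delta.
apply: eq_bigr => J _; rewrite mulrA -ga mulr_sumr; apply: eq_bigr => k _.
rewrite mulr_suml; apply: eq_bigr => n _; rewrite mulr_suml.
by apply: eq_bigr => k' _; rewrite E mulrC.
Qed.

Local Notation sum4 F := (\sum_J \sum_k \sum_n \sum_k' F J k n k').

Lemma relabel4 (F : I -> I -> I -> I -> C) :
  sum4 F = \sum_J \sum_k \sum_n \sum_k' F J k' n k.
Proof.
apply: eq_bigr => J _; rewrite exchange_big [RHS]exchange_big /=.
by apply: eq_bigr => n _; rewrite exchange_big.
Qed.

Lemma sum23' i l i' l' : \sum_j \sum_k T i j k l * (T i' j k l')^* =
  (i' == i)%:R * (l == l')%:R.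
Proof. by rewrite (sum23 HT) eq_sym. Qed.

Lemma sum13' j l j' l' : \sum_i \sum_k T i j k l * (T i j' k l')^* =
  (j' == j)%:R * (l == l')%:R.
Proof. by rewrite (sum13 HT) eq_sym. Qed.

Section Expand.
Variables i i' j j' l l' m m' : I.
Let h a b := \sum_k T i j k a * (T i' j' k b)^*.
(** The seven terms of [swap_relation] after contraction. Orthogonality evaluates six of them; [D]
    is the slot of the last one, where legs 3 and 4 are both swapped. *)
Let rest (D : C) := (i == i')%:R * (l == l')%:R * ((j == j')%:R * (m == m')%:R)
  + D + (m == l')%:R * h l m' + (l == m')%:R * h m l'
  - (l == l')%:R * h m m' - (m == m')%:R * h l l'
  - (i == i')%:R * (m == l')%:R * ((j == j')%:R * (l == m')%:R).

Lemma contract_expand_ket :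
  sum4 (fun J k n k' => (T i J k' l * T n j k m) * ((T i' J k l')^* * (T n j' k' m')^*)) =
  rest (sum4 (fun J k n k' => (T i J k' m * T n j k l) * ((T i' J k l')^* * (T n j' k' m')^*))).
Proof.
pose b J k n k' := (T i' J k l')^* * (T n j' k' m')^*.
have E0 : sum4 (fun J k n k' => (T i J k l * T n j k' m) * b J k n k') =
    (i == i')%:R * (l == l')%:R * ((j == j')%:R * (m == m')%:R).
  by rewrite -(sum23 HT) -(sum13 HT); apply: factor4 => *; rewrite /b mulrACA.
have E4 : sum4 (fun J k n k' => (T i J k m * T n j k' l) * b J k n k') =
    (i == i')%:R * (m == l')%:R * ((j == j')%:R * (l == m')%:R).
  by rewrite -(sum23 HT) -(sum13 HT); apply: factor4 => *; rewrite /b mulrACA.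
have E14 : sum4 (fun J k n k' => (T n J k m * T i j k' l) * b J k n k') = (m == l')%:R * h l m'.
  apply: (@factorL (fun n J k => T n J k m * (T i' J k l')^*)
           (fun n k' => T i j k' l * (T n j' k' m')^*)) => *; last exact: (sum23 HT).
  by rewrite /b mulrACA.
have E1 : sum4 (fun J k n k' => (T n J k l * T i j k' m) * b J k n k') = (l == l')%:R * h m m'.
  apply: (@factorL (fun n J k => T n J k l * (T i' J k l')^*)
           (fun n k' => T i j k' m * (T n j' k' m')^*)) => *; last exact: (sum23 HT).
  by rewrite /b mulrACA.
have E24 : sum4 (fun J k n k' => (T i j k m * T n J k' l) * b J k n k') = (l == m')%:R * h m l'.
  apply: (@factorR (fun J k => T i j k m * (T i' J k l')^*)
           (fun J n k' => T n J k' l * (T n j' k' m')^*)) => *; last exact: (sum13 HT).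
  by rewrite /b mulrACA.
have E2 : sum4 (fun J k n k' => (T i j k l * T n J k' m) * b J k n k') = (m == m')%:R * h l l'.
  apply: (@factorR (fun J k => T i j k l * (T i' J k l')^*)
           (fun J n k' => T n J k' m * (T n j' k' m')^*)) => *; last exact: (sum13 HT).
  by rewrite /b mulrACA.
rewrite /rest -E0 -E4 -E14 -E1 -E24 -E2.
do 4 (rewrite -!(sumrB, big_split) /=; apply: eq_bigr => ? _).
by rewrite swap_relation /b; ring.
Qed.

Lemma contract_expand_bra :
  sum4 (fun J k n k' => (T i J k' m * T n j k l) * ((T i' J k m')^* * (T n j' k' l')^*)) =
  rest (sum4 (fun J k n k' => (T i J k' m * T n j k l) * ((T i' J k l')^* * (T n j' k' m')^*))).
Proof.
rewrite relabel4 [in RHS]relabel4.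
pose b J k n k' := T i J k m * T n j k' l.
have E0 : sum4 (fun J k n k' => b J k n k' * ((T i' J k m')^* * (T n j' k' l')^*)) =
    (i == i')%:R * (l == l')%:R * ((j == j')%:R * (m == m')%:R).
  transitivity ((i == i')%:R * (m == m')%:R * ((j == j')%:R * (l == l')%:R) : C); last by ring.
  by rewrite -(sum23 HT) -(sum13 HT); apply: factor4 => *; rewrite /b mulrACA.
have E4 : sum4 (fun J k n k' => b J k n k' * ((T i' J k l')^* * (T n j' k' m')^*)) =
    (i == i')%:R * (m == l')%:R * ((j == j')%:R * (l == m')%:R).
  by rewrite -(sum23 HT) -(sum13 HT); apply: factor4 => *; rewrite /b mulrACA.
have E14 : sum4 (fun J k n k' => b J k n k' * ((T n J k l')^* * (T i' j' k' m')^*)) = (m == l')%:R * h l m'.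
  apply: (@factorL (fun n J k => T i J k m * (T n J k l')^*)
           (fun n k' => T n j k' l * (T i' j' k' m')^*)) => *; last exact: sum23'.
  by rewrite /b mulrACA.
have E1 : sum4 (fun J k n k' => b J k n k' * ((T n J k m')^* * (T i' j' k' l')^*)) = (m == m')%:R * h l l'.
  apply: (@factorL (fun n J k => T i J k m * (T n J k m')^*)
           (fun n k' => T n j k' l * (T i' j' k' l')^*)) => *; last exact: sum23'.
  by rewrite /b mulrACA.
have E24 : sum4 (fun J k n k' => b J k n k' * ((T i' j' k l')^* * (T n J k' m')^*)) = (l == m')%:R * h m l'.
  apply: (@factorR (fun J k => T i J k m * (T i' j' k l')^*)
           (fun J n k' => T n j k' l * (T n J k' m')^*)) => *; last exact: sum13'.
  by rewrite /b mulrACA.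
have E2 : sum4 (fun J k n k' => b J k n k' * ((T i' j' k m')^* * (T n J k' l')^*)) = (l == l')%:R * h m m'.
  apply: (@factorR (fun J k => T i J k m * (T i' j' k m')^*)
           (fun J n k' => T n j k' l * (T n J k' l')^*)) => *; last exact: sum13'.
  by rewrite /b mulrACA.
rewrite /rest -E0 -E4 -E14 -E1 -E24 -E2.
rewrite -!(sumrB, big_split) /=; apply: eq_bigr => J _.
rewrite -!(sumrB, big_split) /=; apply: eq_bigr => k _.
rewrite -!(sumrB, big_split) /=; apply: eq_bigr => n _.
rewrite -!(sumrB, big_split) /=; apply: eq_bigr => k' _.
by rewrite -!rmorphM /= (swap_relation i' n J j' k k' m' l') /b !(rmorphB, rmorphD) /=; ring.
Qed.

End Expand.

(** Both sides equal [rest] of the same contraction, in which [l] and [m] are exchanged in the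
    unconjugated factors while [l'] and [m'] stay in place in the conjugated ones. *)
Lemma reduced3_exchange i i' j j' l l' m m' :
  \sum_k \sum_k' reduced3 i i' k k' l l' * reduced3' j j' k' k m m' =
  \sum_k \sum_k' reduced3 i i' k k' m m' * reduced3' j j' k' k l l'.
Proof.
rewrite !contract_reduced3; apply: etrans (contract_expand_ket _ _ _ _ _ _ _ _) _.
exact/esym/contract_expand_bra.
Qed.

End Identity.
End PerfectTensor.

(** * From the exchange relation to a traceless operator with product image *)

Section Product.
Variable C : numClosedFieldType.
Local Notation I := 'I_3.
Local Notation u := mxtens_unindex.

Lemma sum_tens (V : nmodType) m n (F : 'I_(m * n) -> V) :
  \sum_c F c = \sum_i \sum_j F (mxtens_index (i, j)).
Proof.
rewrite pair_bigA (reindex (@mxtens_index m n)) /=; last first.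
  by exists (@mxtens_unindex m n) => i _; rewrite ?mxtens_indexK ?mxtens_unindexK.
by apply: eq_bigr => -[].
Qed.

Lemma shuffle4 (F : I -> I -> I -> I -> C) :
  \sum_l \sum_l' \sum_k \sum_k' F l l' k k' =
  \sum_k \sum_l \sum_k' \sum_l' F l l' k k'.
Proof.
by rewrite exchange_big22; apply: eq_bigr => k _; rewrite exchange_big.
Qed.

(** Expanding the reductions leaves two inner products of [G], each with a delta in [j, j']; the
    remaining sum over [j = j'] is the factor 3. Permuting the legs of [T] in [G] gives all four
    normalizations that [product_vector] asks for. *)
Lemma gram (G : tensor4 C) :
    (forall a j a' j', \sum_e \sum_f G a j e f * (G a' j' e f)^* =
       (a == a')%:R * (j == j')%:R) ->
  forall a a' b b',
  \sum_e \sum_f \sum_e' \sum_f' (\sum_j G a j e f * (G b j e' f')^*) *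
      (\sum_j G a' j e f * (G b' j e' f')^*)^* =
  3%:R * ((a == a')%:R * (b == b')%:R).
Proof.
move=> orth a a' b b'.
transitivity (\sum_j \sum_j' \sum_e \sum_f \sum_e' \sum_f'
    (G a j e f * (G a' j' e f)^*) * (G b' j' e' f' * (G b j e' f')^*)).
  rewrite [RHS]exchange_big22; apply: eq_bigr => e _; apply: eq_bigr => f _.
  rewrite [RHS]exchange_big22; apply: eq_bigr => e' _; apply: eq_bigr => f' _.
  rewrite mulr_suml; apply: eq_bigr => j _.
  rewrite rmorph_sum mulr_sumr; apply: eq_bigr => j' _.
  by rewrite rmorphM /= conjCK; ring.
transitivity (\sum_(j : I) \sum_(j' : I) (j == j')%:R * ((a == a')%:R * (b == b')%:R : C)).
  apply: eq_bigr => j _; apply: eq_bigr => j' _.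
  rewrite mul_sum2 !orth (eq_sym b') (eq_sym j').
  by case: (j == j'); rewrite /=; ring.
transitivity (\sum_(j : I) ((a == a')%:R * (b == b')%:R : C)).
  by apply: eq_bigr => j _; exact: (sum_delta' j (fun=> _)).
by rewrite sumr_const card_ord [RHS]mulr_natl.
Qed.

Section Tensor.
Variables (T : tensor4 C) (HT : perfect T).

(** The leg-3 pair is the column index of [lmx] and the row index of [rmx]; [rmx] reads it in
    reversed order, so that [lmx a *m rmx b] is literally the contraction in [reduced3_exchange]. *)
Definition lmx (a : I * I) : 'M[C]_(3 * 3) :=
  \matrix_(r, c) reduced3 T (u r).1 (u r).2 (u c).1 (u c).2 a.1 a.2.
Definition rmx (a : I * I) : 'M[C]_(3 * 3) :=
  \matrix_(r, c) reduced3' T (u c).1 (u c).2 (u r).2 (u r).1 a.1 a.2.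

Lemma lmx_rmx a b : lmx a *m rmx b = lmx b *m rmx a.
Proof.
apply/matrixP => r c; rewrite !mxE !sum_tens.
have E x y : \sum_k \sum_k' lmx x r (mxtens_index (k, k')) * rmx y (mxtens_index (k, k')) c =
    \sum_k \sum_k' reduced3 T (u r).1 (u r).2 k k' x.1 x.2 * reduced3' T (u c).1 (u c).2 k' k y.1 y.2.
  by do 2 (apply: eq_bigr => ? _); rewrite !mxE !mxtens_indexK.
by rewrite !E reduced3_exchange.
Qed.

Lemma one_tens (r c : 'I_(3 * 3)) :
  (r == c)%:R = ((u r).1 == (u c).1)%:R * ((u r).2 == (u c).2)%:R :> C.
Proof.
rewrite -(can_eq (@mxtens_unindexK 3 3)) xpair_eqE.
by case: eqP; case: eqP; rewrite /= ?mulr1 ?mulr0.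
Qed.

Lemma scalar3_tens (r c : 'I_(3 * 3)) : (3%:R%:M : 'M[C]_(3 * 3)) r c =
  3%:R * (((u r).1 == (u c).1)%:R * ((u r).2 == (u c).2)%:R).
Proof. by rewrite -one_tens mxE; case: (r == c); rewrite /=; ring. Qed.

Lemma sum_lmxl : \sum_a lmx a *m (map_mx Num.conj (lmx a)^T) = 3%:R%:M.
Proof.
apply/matrixP => r c; rewrite summxE scalar3_tens.
rewrite -(gram (sum34 HT)) -shuffle4 sum_pair; do 2 (apply: eq_bigr => ? _).
by rewrite mxE sum_tens; do 2 (apply: eq_bigr => ? _); rewrite !mxE !mxtens_indexK.
Qed.

Lemma sum_lmxr : \sum_a (map_mx Num.conj (lmx a)^T) *m lmx a = 3%:R%:M.
Proof.
apply/matrixP => r c; rewrite summxE scalar3_tens.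
rewrite (eq_sym (u r).1) (eq_sym (u r).2).
rewrite -(@gram (fun k j i l => T i j k l)); last by move=> *; rewrite (sum14 HT) mulrC.
rewrite -shuffle4 sum_pair; do 2 (apply: eq_bigr => ? _).
rewrite mxE sum_tens; do 2 (apply: eq_bigr => ? _).
by rewrite !mxE !mxtens_indexK mulrC.
Qed.

Lemma sum_rmxl : \sum_a rmx a *m (map_mx Num.conj (rmx a)^T) = 3%:R%:M.
Proof.
apply/matrixP => r c; rewrite summxE scalar3_tens (mulrC (_ == _)%:R).
rewrite -(@gram (fun k i j l => T i j k l)); last by move=> *; rewrite (sum24 HT) mulrC.
rewrite -shuffle4 sum_pair; do 2 (apply: eq_bigr => ? _).
rewrite mxE sum_tens; do 2 (apply: eq_bigr => ? _).
by rewrite !mxE !mxtens_indexK.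
Qed.

Lemma sum_rmxr : \sum_a (map_mx Num.conj (rmx a)^T) *m rmx a = 3%:R%:M.
Proof.
apply/matrixP => r c; rewrite summxE scalar3_tens.
rewrite (eq_sym (u r).1) (eq_sym (u r).2).
rewrite -(@gram (fun j i k l => T i j k l)); last by move=> *; rewrite (sum34 HT) mulrC.
rewrite -shuffle4 sum_pair; do 2 (apply: eq_bigr => ? _).
rewrite mxE sum_tens exchange_big; do 2 (apply: eq_bigr => ? _).
by rewrite !mxE !mxtens_indexK mulrC.
Qed.

(** By [gram], the squared Hilbert-Schmidt norm of this matrix is 3. *)
Lemma lmx_neq0 : lmx (ord0, 1) != 0.
Proof.
apply/negP => /eqP z.
have orth a j a' j' : \sum_i \sum_k T i j k a * (T i j' k a')^* = (a == a')%:R * (j == j')%:R.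
  by rewrite (sum13 HT) mulrC.
have := gram (G := fun l j i k => T i j k l) orth ord0 ord0 1 1.
rewrite !eqxx !mulr1 => e; suff : 3%:R = 0 :> C by move/eqP; rewrite pnatr_eq0.
rewrite -e big1 // => i _; rewrite big1 // => k _; rewrite big1 // => i' _.
rewrite big1 // => k' _.
have := congr1 (fun M : 'M_(3 * 3) => M (mxtens_index (i, i')) (mxtens_index (k, k'))) z.
by rewrite !mxE !mxtens_indexK /= /reduced3 => ->; rewrite mul0r.
Qed.

(** Tracing leg 3 of the reduction at [(l, l')] leaves a delta in [l, l'], which is 0 at
    [(0, 1)]. *)
Lemma lmx_traceless (x : 'rV[C]_(3 * 3)) :
  (x <= lmx (ord0, 1))%MS -> \sum_k x 0 (mxtens_index (k, k)) = 0.
Proof.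
move=> /submxP[y ->].
under eq_bigr do rewrite mxE.
rewrite exchange_big big1 //= => r _; rewrite -mulr_sumr.
suff -> : \sum_k lmx (ord0, 1) r (mxtens_index (k, k)) = 0 by rewrite mulr0.
transitivity (\sum_j \sum_k T (u r).1 j k ord0 * (T (u r).2 j k 1)^*).
  by rewrite exchange_big; apply: eq_bigr => k _; rewrite mxE mxtens_indexK.
by rewrite (sum23 HT) mulr0.
Qed.

Lemma product_operator : exists X Y M : 'M[C]_3, [/\ X != 0, \tr X = 0 &
  forall j j' l l', \sum_k \sum_k' X k' k * reduced3' T j j' k k' l l' = Y j j' * M l l'].
Proof.
have [x [y [m [x0 xP xQ]]]] := product_vector lmx_rmx sum_lmxl sum_rmxl sum_lmxr sum_rmxr lmx_neq0.
exists (\matrix_(k, k') x 0 (mxtens_index (k, k'))), (\matrix_(j, j') y 0 (mxtens_index (j, j'))).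
exists (\matrix_(l, l') m (l, l')); split.
- apply: contraNneq x0 => z; apply/eqP/rowP => c; have := congr1 (fun X : 'M_3 => X (u c).1 (u c).2) z.
  by rewrite !mxE -surjective_pairing mxtens_unindexK.
- by rewrite -(lmx_traceless xP); apply: eq_bigr => k _; rewrite mxE.
- move=> j j' l l'; have /rowP/(_ (mxtens_index (j, j'))) := xQ (l, l').
  rewrite !mxE mulrC => <-; rewrite sum_tens exchange_big.
  by do 2 (apply: eq_bigr => ? _); rewrite !mxE !mxtens_indexK.
Qed.

End Tensor.
End Product.

(** * Product operators of 2-unitary matrices *)

Section Unitary.
Variable C : numClosedFieldType.
Local Notation unitarymx := (@Defs.unitarymx C _).
Local Notation I := 'I_3.
Local Notation u := mxtens_unindex.

Lemma adjmxE n (M : 'M[C]_n) i j : adjmx M i j = (M j i)^*.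
Proof. by rewrite !mxE. Qed.

Lemma adjmxK n (M : 'M[C]_n) : adjmx (adjmx M) = M.
Proof. by apply/matrixP => i j; rewrite !adjmxE conjCK. Qed.

Lemma adjmx_mul n (A B : 'M[C]_n) : adjmx (A *m B) = adjmx B *m adjmx A.
Proof. by rewrite /adjmx map_mxM trmx_mul. Qed.

Lemma adjmx_tens m n (A : 'M[C]_m) (B : 'M[C]_n) :
  adjmx (A *t B) = adjmx A *t adjmx B.
Proof. by rewrite /adjmx map_mxT trmx_tens. Qed.

Lemma adjmx1 n : adjmx (1%:M : 'M[C]_n) = 1%:M.
Proof. by rewrite /adjmx map_scalar_mx rmorph1 tr_scalar_mx. Qed.

Lemma tens1mx1 n : (1%:M : 'M[C]_n) *t (1%:M : 'M[C]_n) = 1%:M.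
Proof.
apply/matrixP => r c; rewrite !mxE -(can_eq (@mxtens_unindexK n n)).
rewrite (surjective_pairing (u r)) (surjective_pairing (u c)) xpair_eqE /=.
by case: eqP; case: eqP; rewrite /= ?mulr1 ?mulr0.
Qed.

Lemma unitary_mulV n (M : 'M[C]_n) : unitarymx M -> adjmx M *m M = 1%:M.
Proof. by move=> /mulmx1C. Qed.

Lemma unitary_mul n (A B : 'M[C]_n) : unitarymx A -> unitarymx B -> unitarymx (A *m B).
Proof.
move=> hA hB; rewrite /Defs.unitarymx adjmx_mul mulmxA -(mulmxA A) hB mulmx1.
exact: hA.
Qed.

Lemma unitary_adj n (A : 'M[C]_n) : unitarymx A -> unitarymx (adjmx A).
Proof. by move=> hA; rewrite /Defs.unitarymx adjmxK unitary_mulV. Qed.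

Lemma unitary_tr n (A : 'M[C]_n) : unitarymx A -> unitarymx A^T.
Proof.
move=> /unitary_mulV hA; rewrite /Defs.unitarymx -[RHS](trmx1 C n) -hA trmx_mul.
by congr (_ *m _); apply/matrixP => i j; rewrite !mxE.
Qed.

Lemma unitary1 n : unitarymx (1%:M : 'M[C]_n).
Proof. by rewrite /Defs.unitarymx adjmx1 mulmx1. Qed.

Lemma unitary_tens n (A B : 'M[C]_n) : unitarymx A -> unitarymx B -> unitarymx (A *t B).
Proof.
by move=> hA hB; rewrite /Defs.unitarymx adjmx_tens tensmx_mul hA hB tens1mx1.
Qed.

Lemma unitary_rows n (M : 'M[C]_(n * n)) : unitarymx M -> forall a b a' b',
  \sum_c \sum_d M (pidx a b) (pidx c d) * (M (pidx a' b') (pidx c d))^* =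
  (a == a')%:R * (b == b')%:R.
Proof.
move=> /matrixP hM a b a' b'; have := hM (pidx a b) (pidx a' b').
rewrite mxE -tens1mx1 tensmxE !mxE sum_tens => <-.
by do 2 (apply: eq_bigr => ? _); rewrite adjmxE.
Qed.

Lemma unitary_cols n (M : 'M[C]_(n * n)) : unitarymx M -> forall a b a' b',
  \sum_c \sum_d M (pidx c d) (pidx a b) * (M (pidx c d) (pidx a' b'))^* =
  (a == a')%:R * (b == b')%:R.
Proof.
move=> /unitary_tr/unitary_rows hM a b a' b'; rewrite -hM.
by do 2 (apply: eq_bigr => ? _); rewrite !mxE.
Qed.

Lemma unitary_of_rows n (M : 'M[C]_(n * n)) : (forall a b a' b',
  \sum_c \sum_d M (pidx a b) (pidx c d) * (M (pidx a' b') (pidx c d))^* =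
  (a == a')%:R * (b == b')%:R) -> unitarymx M.
Proof.
move=> hM; apply/matrixP => r s.
case: (mxtens_indexP r) => a b; case: (mxtens_indexP s) => a' b'.
rewrite mxE -tens1mx1 tensmxE !mxE sum_tens -hM.
by do 2 (apply: eq_bigr => ? _); rewrite adjmxE.
Qed.

Lemma realignE n (U : 'M[C]_(n * n)) a b c d :
  realign U (pidx a b) (pidx c d) = U (pidx a c) (pidx b d).
Proof. by rewrite mxE /unpidx !mxtens_indexK. Qed.

Lemma ptransE n (U : 'M[C]_(n * n)) a b c d :
  ptrans U (pidx a b) (pidx c d) = U (pidx a d) (pidx c b).
Proof. by rewrite mxE /unpidx !mxtens_indexK. Qed.

Definition mxtensor (U : 'M[C]_(3 * 3)) : tensor4 C :=
  fun i j k l => U (pidx i j) (pidx k l).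

(** Each of the three unitary matrices supplies two of the six relations, one by its columns and one
    by its rows. *)
Lemma perfect_mxtensor U : two_unitary U -> perfect (mxtensor U).
Proof.
case=> hU hR hP; split.
- exact: unitary_cols.
- move=> *; rewrite -(unitary_cols hR).
  by do 2 (apply: eq_bigr => ? _); rewrite !realignE.
- move=> j k j' k'; rewrite [RHS]mulrC -(unitary_cols hP).
  by do 2 (apply: eq_bigr => ? _); rewrite !ptransE.
- move=> i l i' l'; rewrite -(unitary_rows hP) exchange_big.
  by do 2 (apply: eq_bigr => ? _); rewrite !ptransE.
- move=> *; rewrite -(unitary_rows hR).
  by do 2 (apply: eq_bigr => ? _); rewrite !realignE.
- exact: unitary_rows.
Qed.

(** With this relabelling the leg traced by [reduced3'] is the first input of [U], leg 3 is the
    second input, and legs 2 and 4 are the outputs: [reduced3'] becomes the kernel of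
    [N |-> U (1 (x) N) U^*]. *)
Lemma perfect_perm (T : tensor4 C) : perfect T -> perfect (fun i j k l => T j l i k).
Proof.
case=> h12 h13 h14 h23 h24 h34; split=> *.
- by rewrite exchange_big h13 mulrC.
- by rewrite h34.
- by rewrite exchange_big h23.
- by rewrite h14 mulrC.
- by rewrite h12.
- by rewrite exchange_big h24 mulrC.
Qed.

Lemma conj_tensE (U : 'M[C]_(3 * 3)) (N : 'M[C]_3) j l j' l' :
  (U *m (1%:M *t N) *m adjmx U) (pidx j l) (pidx j' l') =
  \sum_k \sum_k' N k k' * \sum_i U (pidx j l) (pidx i k) * (U (pidx j' l') (pidx i k'))^*.
Proof.
rewrite mxE sum_tens.
transitivity (\sum_i \sum_k' \sum_k N k k' * (U (pidx j l) (pidx i k) * (U (pidx j' l') (pidx i k'))^*)).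
  apply: eq_bigr => i _; apply: eq_bigr => k' _.
  rewrite adjmxE mxE sum_tens exchange_big mulr_suml; apply: eq_bigr => k _.
  under eq_bigr => i' _ do rewrite tensmxE mxE mulrCA.
  by rewrite sum_delta /pidx; ring.
rewrite exchange_big [RHS]exchange_big; apply: eq_bigr => k' _.
by rewrite exchange_big; apply: eq_bigr => k _; rewrite mulr_sumr.
Qed.

Lemma exists_product_operator (U : 'M[C]_(3 * 3)) : two_unitary U ->
  exists N Y M : 'M[C]_3,
    [/\ N != 0, \tr N = 0 & U *m (1%:M *t N) *m adjmx U = Y *t M].
Proof.
move=> /perfect_mxtensor/perfect_perm/product_operator[X [Y [M [X0 trX XYM]]]].
exists X^T, Y, M; split.
- by apply: contraNneq X0 => /(congr1 trmx); rewrite trmxK trmx0 => ->.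
- by rewrite mxtrace_tr.
apply/matrixP => r s; case: (mxtens_indexP r) => j l; case: (mxtens_indexP s) => j' l'.
rewrite conj_tensE tensmxE -XYM; do 2 (apply: eq_bigr => ? _).
by rewrite mxE.
Qed.

(** By [sum23] and [sum13], both partial traces of [U (1 (x) N) U^*] are [tr N] times the identity,
    whatever [N] is. *)
Lemma partial_traces (U : 'M[C]_(3 * 3)) (N Y M : 'M[C]_3) : two_unitary U ->
  U *m (1%:M *t N) *m adjmx U = Y *t M ->
  \tr M *: Y = (\tr N)%:M /\ \tr Y *: M = (\tr N)%:M.
Proof.
move=> /perfect_mxtensor hU /matrixP e.
have eE j l j' l' : Y j j' * M l l' =
    \sum_k \sum_k' N k k' * \sum_i mxtensor U j l i k * (mxtensor U j' l' i k')^*.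
  by rewrite -conj_tensE e tensmxE.
split; apply/matrixP => j j'; rewrite !mxE [LHS]mulrC mulr_sumr.
  under eq_bigr do rewrite eE.
  rewrite exchange_big; under eq_bigr do rewrite exchange_big.
  transitivity (\sum_k \sum_k' (k == k')%:R * (N k k' * (j == j')%:R)).
    apply: eq_bigr => k _; apply: eq_bigr => k' _.
    rewrite -mulr_sumr (sum23 hU) mulrCA mulrC; ring.
  by under eq_bigr do rewrite sum_delta'; rewrite -mulr_suml mulr_natr.
under eq_bigr do rewrite mulrC eE.
rewrite exchange_big; under eq_bigr do rewrite exchange_big.
transitivity (\sum_k \sum_k' (k == k')%:R * (N k k' * (j == j')%:R)).
  apply: eq_bigr => k _; apply: eq_bigr => k' _.
  rewrite -mulr_sumr (sum13 hU); ring.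
by under eq_bigr do rewrite sum_delta'; rewrite -mulr_suml mulr_natr.
Qed.

End Unitary.

(** * Local unitary moves, and why the product operators are multiples of clock matrices *)

Section Pauli.
Variable C : numClosedFieldType.
Local Notation unitarymx := (@Defs.unitarymx C _).
Local Notation I := 'I_3.
Local Notation u := mxtens_unindex.

Lemma LU_entries n (a b c d : 'M[C]_n) (U : 'M[C]_(n * n)) i j k l :
  ((a *t b) *m U *m (c *t d)) (pidx i j) (pidx k l) =
  \sum_p \sum_q \sum_s \sum_t a i p * b j q * U (pidx p q) (pidx s t) * (c s k * d t l).
Proof.
rewrite mxE sum_tens [RHS]exchange_big22; do 2 (apply: eq_bigr => ? _).
rewrite mxE sum_tens mulr_suml; apply: eq_bigr => p _.
by rewrite mulr_suml; apply: eq_bigr => q _; rewrite !tensmxE.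
Qed.

(** Realignment exchanges the second output with the first input, so [b] and [c] change sides and
    are transposed. For the partial transpose the second input takes that place. *)
Lemma realign_LU n (a b c d : 'M[C]_n) (U : 'M[C]_(n * n)) :
  realign ((a *t b) *m U *m (c *t d)) = (a *t c^T) *m realign U *m (b^T *t d).
Proof.
apply/matrixP => r s; case: (mxtens_indexP r) => r1 r2; case: (mxtens_indexP s) => c1 c2.
rewrite realignE !LU_entries; apply: eq_bigr => p _; rewrite exchange_big /=.
apply: eq_bigr => s' _; apply: eq_bigr => q _; apply: eq_bigr => t _.
by rewrite realignE ![_^T _ _]mxE; ring.
Qed.

Lemma ptrans_LU n (a b c d : 'M[C]_n) (U : 'M[C]_(n * n)) :
  ptrans ((a *t b) *m U *m (c *t d)) = (a *t d^T) *m ptrans U *m (c *t b^T).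
Proof.
apply/matrixP => r s; case: (mxtens_indexP r) => r1 r2; case: (mxtens_indexP s) => c1 c2.
rewrite ptransE !LU_entries; apply: eq_bigr => p _.
rewrite exchange_big /=; under eq_bigr => s' _ do rewrite exchange_big /=.
rewrite exchange_big /=; apply: eq_bigr => t _; apply: eq_bigr => s' _.
by apply: eq_bigr => q _; rewrite ptransE ![_^T _ _]mxE; ring.
Qed.

(** Doubled, so that the second elementary symmetric function is written with traces and no
    division; [e] is twice the determinant. *)
Lemma cayley_hamilton3 (Y : 'M[C]_3) : exists e,
  Y *m Y *m Y *+ 2 = (\tr Y *: (Y *m Y)) *+ 2
    - ((\tr Y) ^+ 2 - \tr (Y *m Y)) *: Y + e%:M.
Proof.
pose x i j := Y (inord i) (inord j).
exists ((x 0 0 * (x 1 1 * x 2 2 - x 1 2 * x 2 1)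
      - x 0 1 * (x 1 0 * x 2 2 - x 1 2 * x 2 0)
      + x 0 2 * (x 1 0 * x 2 1 - x 1 1 * x 2 0)) *+ 2)%N.
have YE (i j : 'I_3) : Y i j = x i j by rewrite /x !inord_val.
apply/matrixP => i j; rewrite !mxE.
have trE (A : 'M[C]_3) : \tr A = \sum_i A i i by [].
rewrite !trE; do ! (rewrite ?big_ord_recl ?big_ord0 ?mxE /=).
rewrite !YE /= /bump /=.
case: i => -[|[|[|//]]] ?; case: j => -[|[|[|//]]] ?; rewrite /= !addn0 ?add1n; ring.
Qed.

Lemma unitary_LU n (a b c d : 'M[C]_n) (U : 'M[C]_(n * n)) :
  unitarymx a -> unitarymx b -> unitarymx c -> unitarymx d ->
  unitarymx U -> unitarymx ((a *t b) *m U *m (c *t d)).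
Proof.
by move=> *; apply: unitary_mul; [apply: unitary_mul|] => //; apply: unitary_tens.
Qed.

Lemma two_unitary_LU n (U U' : 'M[C]_(n * n)) :
  LU_equiv_mx U U' -> two_unitary U -> two_unitary U'.
Proof.
case=> [a [b [c [d [ha hb hc hd ->]]]]] [hU hR hP]; split.
- exact: unitary_LU.
- by rewrite realign_LU; apply: unitary_LU => //; apply: unitary_tr.
- by rewrite ptrans_LU; apply: unitary_LU => //; apply: unitary_tr.
Qed.

Lemma LU_trans n (U1 U2 U3 : 'M[C]_(n * n)) :
  LU_equiv_mx U1 U2 -> LU_equiv_mx U2 U3 -> LU_equiv_mx U1 U3.
Proof.
case=> [a [b [c [d [ha hb hc hd ->]]]]] [a' [b' [c' [d' [ha' hb' hc' hd' ->]]]]].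
exists (a' *m a), (b' *m b), (c *m c'), (d *m d').
by split; try exact: unitary_mul; rewrite -!tensmx_mul !mulmxA.
Qed.

Lemma LU_sym n (U1 U2 : 'M[C]_(n * n)) : LU_equiv_mx U1 U2 -> LU_equiv_mx U2 U1.
Proof.
case=> [a [b [c [d [ha hb hc hd ->]]]]].
exists (adjmx a), (adjmx b), (adjmx c), (adjmx d).
split; try exact: unitary_adj.
rewrite !mulmxA -mulmxA !tensmx_mul hc hd.
by rewrite !unitary_mulV // !tens1mx1 mulmx1 mul1mx.
Qed.

Lemma scalar_inj n (a b : C) : (a%:M : 'M[C]_n.+1) = b%:M -> a = b.
Proof. by move/matrixP/(_ 0 0); rewrite !mxE eqxx !mulr1n. Qed.

Lemma scalar_unit n (A : 'M[C]_n.+1) c : c != 0 -> A *m adjmx A = c%:M -> A \in unitmx.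
Proof.
move=> c0 e; apply: (proj1 (@mulmx1_unit _ _ A (c^-1 *: adjmx A) _)).
by rewrite -scalemxAr e scale_scalar_mx mulVf.
Qed.

(** If [Y^2 = k], Cayley-Hamilton reads [2 k Y = 3 k Y + e], so [Y] is scalar; being traceless it is
    0, against invertibility. *)
Lemma traceless_sqr_not_scalar (Y : 'M[C]_3) (c k : C) : c != 0 -> Y *m adjmx Y = c%:M ->
  \tr Y = 0 -> Y *m Y = k%:M -> False.
Proof.
move=> c0 Yc tY Y2; have Yu := scalar_unit c0 Yc.
have k0 : k != 0.
  apply/eqP => k0; have := Yu; suff -> : Y = 0 by rewrite unitmxE det0 unitr0.
  by rewrite -[Y](mulmxK Yu) Y2 k0 raddf0 mul0mx.
have [e he] := cayley_hamilton3 Y.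
have YE : Y = (- e / k)%:M.
  apply/matrixP => i j; have := congr1 (fun A : 'M_3 => A i j) he.
  rewrite /= tY Y2 mxtrace_scalar mul_scalar_mx scale0r !mxE => h.
  apply: (mulfI k0); rewrite mulrnAr mulrCA mulfV // mulr1 mulNrn.
  transitivity ((0 *+ 2 - (0 ^+ 2 - k *+ 3) * Y i j + e *+ (i == j)) - (k * Y i j) *+ 2 - e *+ (i == j)).
    by ring.
  by rewrite -h; ring.
have := Yu; suff -> : Y = 0 by rewrite unitmxE det0 unitr0.
move: tY; rewrite YE mxtrace_scalar => /eqP; rewrite mulrn_eq0 /= => /eqP ->.
by rewrite raddf0.
Qed.

(** Nonzero multiples of unitaries with characteristic polynomial [t^3 - e]: up to unitary
    conjugation, a cube root of [e] times [diag(1, w, w^2)], with [w] a primitive cube root of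
    unity. *)
Definition clock_like (Y : 'M[C]_3) (e : C) : Prop :=
  [/\ e != 0, exists2 c, c != 0 & Y *m adjmx Y = c%:M, \tr Y = 0,
      \tr (Y *m Y) = 0 & Y *m Y *m Y = e%:M].

Lemma clock_likeI (Y : 'M[C]_3) c : c != 0 -> Y *m adjmx Y = c%:M ->
  \tr Y = 0 -> \tr (Y *m Y) = 0 -> exists e, clock_like Y e.
Proof.
move=> c0 Yc tY tY2; have Yu := scalar_unit c0 Yc.
have [e he] := cayley_hamilton3 Y.
have Y3 : Y *m Y *m Y = (e / 2%:R)%:M.
  move: he; rewrite tY tY2 scale0r mul0rn expr0n /= subrr scale0r subrr add0r => he.
  apply/matrixP => i j; have := congr1 (fun A : 'M_3 => A i j) he.
  rewrite /= !mxE => h; apply: (@mulIf _ 2%:R); first by rewrite pnatr_eq0.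
  by rewrite mulr_natr mulr2n h mulrnAl -mulrA mulVf ?pnatr_eq0 ?mulr1.
exists (e / 2%:R); split => //; last by exists c.
have YYY : Y *m Y *m Y \in unitmx by rewrite !unitmx_mul Yu.
by apply: contraTneq YYY; rewrite Y3 => ->; rewrite raddf0 unitmxE det0 unitr0.
Qed.

Lemma tens_eq0 (Y M : 'M[C]_3) : Y *t M != 0 -> Y != 0 /\ M != 0.
Proof.
move=> YM; split; apply: contraNneq YM => ->; first by rewrite tens0mx.
by rewrite tensmx0.
Qed.

Lemma tens_scalar (a b : C) : (a%:M : 'M_3) *t (b%:M : 'M_3) = (a * b)%:M.
Proof.
rewrite -[a%:M]scalemx1 -[b%:M]scalemx1 -[RHS]scalemx1 -(tens1mx1 C 3).
by apply/matrixP => i j; rewrite !mxE; ring.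
Qed.

Lemma tens1_inj (A B : 'M[C]_3) : (1%:M : 'M_3) *t A = (1%:M : 'M_3) *t B -> A = B.
Proof.
move=> /matrixP e; apply/matrixP => i j.
by have := e (pidx 0 i) (pidx 0 j); rewrite !tensmxE mxE eqxx !mul1r.
Qed.

Lemma tr_mul_adj_neq0 (A : 'M[C]_3) : A != 0 -> \tr (A *m adjmx A) != 0.
Proof.
apply: contraNneq => t0; apply/eqP/matrixP => i j; rewrite mxE; move/eqP: t0.
have A0 k l : 0 <= A k l * adjmx A l k by rewrite adjmxE mul_conjC_ge0.
rewrite psumr_eq0 => [/allP /(_ i)|k _]; last by rewrite mxE sumr_ge0.
rewrite mem_index_enum mxE => /(_ isT); rewrite psumr_eq0 => [/allP /(_ j)|//].
by rewrite mem_index_enum adjmxE mul_conjC_eq0 => /(_ isT)/eqP.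
Qed.

(** [A |-> U (1 (x) A) U^*] respects products and adjoints, so [N N^*] and [N^2] have product images
    too and [partial_traces] applies to them. The first makes [Y Y^*] and [M M^*] scalar. The second
    forces [tr (M^2) = 0], since otherwise [Y^2] would be scalar, and likewise [tr (Y^2) = 0]. *)
Lemma clock_like_factors (U : 'M[C]_(3 * 3)) (N Y M : 'M[C]_3) :
    two_unitary U -> N != 0 -> \tr N = 0 -> U *m (1%:M *t N) *m adjmx U = Y *t M ->
  exists a b, [/\ clock_like Y a, clock_like M b & clock_like N (a * b)].
Proof.
move=> tU; case: (tU) => hU _ _ N0 tN NYM.
have UV := unitary_mulV hU.
pose rel (A B D : 'M[C]_3) := U *m (1%:M *t A) *m adjmx U = B *t D.
have relM A B D A' B' D' : rel A B D -> rel A' B' D' -> rel (A *m A') (B *m B') (D *m D').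
  rewrite /rel; have <- : ((1%:M : 'M_3) *t A) *m ((1%:M : 'M_3) *t A') = 1%:M *t (A *m A').
    by rewrite tensmx_mul mulmx1.
  by rewrite -tensmx_mul => <- <-; rewrite !mulmxA -(mulmxA _ (adjmx U) U) UV mulmx1.
have relA A B D : rel A B D -> rel (adjmx A) (adjmx B) (adjmx D).
  by rewrite /rel -adjmx_tens => <-; rewrite !adjmx_mul adjmxK adjmx_tens adjmx1 mulmxA.
have relK A k : U *m (1%:M *t A) *m adjmx U = k%:M -> A = k%:M.
  move=> e; apply: tens1_inj; have := congr1 (fun X => adjmx U *m X *m U) e.
  rewrite !mulmxA UV mul1mx -mulmxA UV mulmx1 => ->.
  by rewrite mul_mx_scalar -scalemxAl UV tens_scalar mul1r scalemx1.
have NYM' : rel N Y M by [].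
have [Y0 M0] : Y != 0 /\ M != 0.
  apply: tens_eq0; rewrite -NYM; apply: contraNneq N0 => e.
  by rewrite (relK N 0) ?raddf0.
have [pt1 pt2] := partial_traces tU NYM'.
rewrite tN raddf0 in pt1 pt2.
have tM : \tr M = 0 by move/eqP: pt1; rewrite scaler_eq0 (negPf Y0) orbF => /eqP.
have tY : \tr Y = 0 by move/eqP: pt2; rewrite scaler_eq0 (negPf M0) orbF => /eqP.
have NN := relM _ _ _ _ _ _ NYM' (relA _ _ _ NYM').
have [a1 a2] := partial_traces tU NN.
have n0 := tr_mul_adj_neq0 N0; have y0 := tr_mul_adj_neq0 Y0; have m0 := tr_mul_adj_neq0 M0.
have scalE (t s : C) (A : 'M[C]_3) : t != 0 -> t *: A = s%:M -> A = (s / t)%:M.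
  move=> t0 e; rewrite -[A]scale1r -(mulVf t0) -scalerA e scale_scalar_mx.
  by rewrite mulrC.
have Yc := scalE _ _ _ m0 a1; have Mc := scalE _ _ _ y0 a2.
have cY0 := mulf_neq0 n0 (invr_neq0 m0); have cM0 := mulf_neq0 n0 (invr_neq0 y0).
have Nc : N *m adjmx N = (\tr (N *m adjmx N) / \tr (M *m adjmx M) *
    (\tr (N *m adjmx N) / \tr (Y *m adjmx Y)))%:M.
  by apply: relK; rewrite NN [X in X *t _]Yc [X in _ *t X]Mc tens_scalar.
have cN0 := mulf_neq0 cY0 cM0.
have NN2 := relM _ _ _ _ _ _ NYM' NYM'.
have [b1 b2] := partial_traces tU NN2.
have tM2 : \tr (M *m M) = 0.
  by apply/eqP; apply: contraT => t0; case: (traceless_sqr_not_scalar cY0 Yc tY (scalE _ _ _ t0 b1)).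
have tY2 : \tr (Y *m Y) = 0.
  by apply/eqP; apply: contraT => t0; case: (traceless_sqr_not_scalar cM0 Mc tM (scalE _ _ _ t0 b2)).
have tN2 : \tr (N *m N) = 0.
  by move: b1; rewrite tM2 scale0r -(raddf0 (@scalar_mx C 3)) => /scalar_inj.
have [a ha] := clock_likeI cY0 Yc tY tY2; have [b hb] := clock_likeI cM0 Mc tM tM2.
have [c hc] := clock_likeI cN0 Nc tN tN2.
exists a, b; split => //; suff <- : c = a * b by [].
have [_ _ _ _ Y3] := ha; have [_ _ _ _ M3] := hb; have [_ _ _ _ N3] := hc.
apply: (@scalar_inj 2); rewrite -N3; apply: relK.
by rewrite (relM _ _ _ _ _ _ NN2 NYM') Y3 M3 tens_scalar.
Qed.

(** * Diagonalization with a primitive cube root of unity *)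

Section Omega.
Variable w : C.
Hypothesis w1 : w ^+ 2 + w + 1 = 0.

Lemma omega3 : w ^+ 3 = 1.
Proof.
have -> : w ^+ 3 = (w ^+ 2 + w + 1) * (w - 1) + 1 by ring.
by rewrite w1 mul0r add0r.
Qed.

Lemma omega_neq1 : w != 1.
Proof.
apply/eqP => e; move: w1; rewrite e expr1n => /eqP.
by rewrite -[1]/(1%:R) -!natrD pnatr_eq0.
Qed.

Lemma omega_norm : `|w| = 1.
Proof.
have := congr1 Num.norm omega3; rewrite normrX normr1 => /eqP.
by rewrite pexpr_eq1 ?normr_ge0 // => /eqP.
Qed.

Lemma omega_mod n : w ^+ (n %% 3) = w ^+ n.
Proof. by rewrite expr_mod ?omega3. Qed.

Lemma omega_inj (m n : I) : w ^+ m = w ^+ n -> m = n.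
Proof.
have w2 : w ^+ 2 != 1.
  apply/eqP => e; have := omega3; rewrite exprS e mulr1 => /eqP.
  by rewrite (negPf omega_neq1).
have w0 : w != 0 by rewrite -normr_eq0 omega_norm oner_eq0.
case: m n => -[|[|[|//]]] hm [[|[|[|//]]] hn]; rewrite /= ?expr0 ?expr1 => e;
  try (by apply: val_inj);
  try (by move: omega_neq1 w2; rewrite e ?eqxx //);
  try (by move: omega_neq1 w2; rewrite -e eqxx).
- by move/eqP: e; rewrite -subr_eq0 expr2 -[X in X - _]mulr1 -mulrBr mulf_eq0
    (negPf w0) subr_eq0 eq_sym (negPf omega_neq1).
- by move/eqP: e; rewrite -subr_eq0 expr2 -[X in _ - X]mulr1 -mulrBr mulf_eq0
    (negPf w0) subr_eq0 (negPf omega_neq1).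
Qed.

(** Unit eigenvectors for [z w^m] and [z w^n] are orthogonal: [Y] scales all inner products by
    [c = z z^*], and theirs by [z z^* w^(m - n)]. *)
Lemma clock_diag (Y : 'M[C]_3) z : clock_like Y (z ^+ 3) ->
  exists W : 'M[C]_3, unitarymx W /\ forall m k, (W *m Y) m k = z * w ^+ m * W m k.
Proof.
case=> z3 [c c0 Yc] tY tY2 Y3.
have z0 : z != 0 by move: z3; rewrite expf_eq0.
have eig (m : I) : exists v : 'rV[C]_3, v *m Y = (z * w ^+ m) *: v /\ \sum_k v 0 k * (v 0 k)^* = 1.
  set t := z * w ^+ m.
  have t3 : t ^+ 3 = z ^+ 3 by rewrite exprMn -exprM mulnC exprM omega3 expr1n mulr1.
  have t0 : t != 0 by move: z3; rewrite -t3 expf_eq0.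
  have /eigenvalueP[v vY v0] : eigenvalue Y t.
    apply: contraT; rewrite negbK => /eqP ker0.
    have un : Y - t%:M \in unitmx by rewrite -row_free_unit -kermx_eq0 -ker0.
    (* The cofactor of [Y - t] in [Y^3 - t^3 = 0] would vanish if [Y - t] were invertible, but its
       trace is [3 t^2]. *)
    have : (Y *m Y + t *: Y + (t ^+ 2)%:M) *m (Y - t%:M) = 0.
      rewrite mulmxBr !mulmxDl Y3 -t3 !mul_mx_scalar mul_scalar_mx -!scalemxAl.
      by apply/matrixP => i j; rewrite !mxE; case: (i == j); rewrite /=; ring.
    move/(congr1 (mulmx^~ (invmx (Y - t%:M)))); rewrite mulmxK // mul0mx => /(congr1 mxtrace).
    rewrite mxtrace0 !mxtraceD mxtraceZ tY tY2 mulr0 !add0r mxtrace_scalar => /eqP.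
    by rewrite mulrn_eq0 /= expf_eq0 (negPf t0).
  have n0 : \sum_k v 0 k * (v 0 k)^* != 0.
    apply: contraNneq v0 => e; apply/eqP/rownorm_le0.
    rewrite le_eqVlt -[X in _ == X]e mxE; apply/orP; left; apply/eqP.
    by apply: eq_bigr => k _; rewrite !mxE.
  have np : 0 <= \sum_k v 0 k * (v 0 k)^* by rewrite sumr_ge0 // => k _; exact: mul_conjC_ge0.
  set n := \sum_k _ in n0 np; pose s := (sqrtC n)^-1.
  exists (s *: v); split; first by rewrite -scalemxAl vY !scalerA mulrC.
  transitivity (s * s^* * n).
    rewrite [in RHS]/n mulr_sumr; apply: eq_bigr => k _; rewrite !mxE rmorphM /=; ring.
  have sr : s \is Num.real by rewrite ger0_real // invr_ge0 sqrtC_ge0.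
  by rewrite (CrealP sr) /s -invfM -expr2 sqrtCK mulVf.
have /fin_all_exists[v hv] := eig.
have vY m := proj1 (hv m); have v1 m := proj2 (hv m).
pose W := \matrix_(m < 3, k < 3) v m 0 k.
have WY m k : (W *m Y) m k = z * w ^+ m * W m k.
  have := congr1 (fun A : 'rV_3 => A 0 k) (vY m); rewrite /= !mxE => <-.
  by apply: eq_bigr => k' _; rewrite !mxE.
exists W; split=> //; apply/matrixP => m n.
have : (W *m Y *m adjmx (W *m Y)) m n = c * (W *m adjmx W) m n.
  rewrite adjmx_mul mulmxA -(mulmxA W) Yc mul_mx_scalar -scalemxAl.
  by rewrite [LHS]mxE.
have SE : (W *m Y *m adjmx (W *m Y)) m n = (z * z^*) * (w ^+ m * (w ^+ n)^*) * (W *m adjmx W) m n.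
  rewrite 2!mxE mulr_sumr; apply: eq_bigr => k _.
  by rewrite !adjmxE !WY !rmorphM /=; ring.
rewrite SE => e.
have diag p : (W *m adjmx W) p p = 1.
  by rewrite mxE -[RHS](v1 p); apply: eq_bigr => k _; rewrite adjmxE !mxE.
rewrite [in RHS]mxE; case: eqVneq => [->|mn]; first by rewrite diag.
have zc : z * z^* = c.
  have : (W *m Y *m adjmx (W *m Y)) m m = c * (W *m adjmx W) m m.
    by rewrite adjmx_mul mulmxA -(mulmxA W) Yc mul_mx_scalar -scalemxAl mxE.
  rewrite diag mulr1 => <-; rewrite mxE.
  transitivity (z * z^* * (w ^+ m * (w ^+ m)^*) * (W *m adjmx W) m m).
    by rewrite diag -[w ^+ m * _]normCK normrX omega_norm !expr1n !mulr1.
  rewrite [in LHS]mxE mulr_sumr; apply: eq_bigr => k _.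
  by rewrite !adjmxE !WY !rmorphM /=; ring.
apply/eqP; apply: contraT => W0; have c1 : w ^+ m * (w ^+ n)^* = 1.
  by apply: (mulfI c0); apply: (mulIf W0); rewrite mulr1 -{1}zc.
case/negP: mn; apply/eqP/omega_inj.
have nn : w ^+ n * (w ^+ n)^* = 1 by rewrite -normCK normrX omega_norm !expr1n.
have n0 : (w ^+ n)^* != 0 by apply: contra_eq_neq nn => ->; rewrite mulr0 eq_sym oner_neq0.
by apply: (mulIf n0); rewrite c1 nn.
Qed.

End Omega.
End Pauli.

(** * The canonical form *)

Section Canonical.
Variable C : numClosedFieldType.
Local Notation unitarymx := (@Defs.unitarymx C _).
Local Notation I := 'I_3.
Local Notation u := mxtens_unindex.

Lemma ex_omega : exists w : C, w ^+ 2 + w + 1 = 0.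
Proof.
pose s := sqrtC (- 3%:R : C); have s2 : s ^+ 2 = - 3%:R by rewrite sqrtCK.
exists ((s - 1) / 2%:R); rewrite expr_div_n sqrrB1 s2.
by field.
Qed.

Lemma diag_tens_mul n (a b : 'rV[C]_n) (A : 'M[C]_(n * n)) i j c :
  ((diag_mx a *t diag_mx b) *m A) (pidx i j) c = a 0 i * b 0 j * A (pidx i j) c.
Proof.
rewrite mxE sum_tens (bigD1 i) //= [X in _ + X]big1 => [|p pi]; last first.
  rewrite big1 // => q _; rewrite tensmxE !mxE (eq_sym i) (negPf pi).
  by rewrite !mul0r.
rewrite addr0 (bigD1 j) //= big1 => [|q qj]; last first.
  by rewrite tensmxE !mxE (eq_sym j) (negPf qj) mulr0 mul0r.
by rewrite addr0 tensmxE !mxE !eqxx.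
Qed.

Lemma mul_diag_tens n (a b : 'rV[C]_n) (A : 'M[C]_(n * n)) r k l :
  (A *m (diag_mx a *t diag_mx b)) r (pidx k l) = A r (pidx k l) * (a 0 k * b 0 l).
Proof.
rewrite mxE sum_tens (bigD1 k) //= [X in _ + X]big1 => [|p pk]; last first.
  rewrite big1 // => q _; rewrite tensmxE !mxE (negPf pk).
  by rewrite mul0r mulr0.
rewrite addr0 (bigD1 l) //= big1 => [|q ql]; last first.
  by rewrite tensmxE !mxE (negPf ql) !mulr0.
by rewrite addr0 tensmxE !mxE !eqxx.
Qed.

(** In eigenbases of [Y], [M] and [N], the relation [U (1 (x) N) = (Y (x) M) U] reads
    [w^l = w^i w^j] at every nonzero entry. *)
Lemma shift_support (U : 'M[C]_(3 * 3)) : two_unitary U ->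
  exists2 U', LU_equiv_mx U U' &
    forall i j k l, U' (pidx i j) (pidx k l) != 0 -> l = i + j.
Proof.
move=> tU; have [w w1] := ex_omega.
have [N [Y [M [N0 tN NYM]]]] := exists_product_operator tU.
have [a [b [hY hM hN]]] := clock_like_factors tU N0 tN NYM.
pose y := 3.-root a; pose m := 3.-root b.
rewrite -[a](rootCK (isT : 0 < 3)%N) in hY hN.
rewrite -[b](rootCK (isT : 0 < 3)%N) in hM hN.
(* The cube root chosen for [N] is the product of those for [Y] and [M]; another cube root of
   [a * b] would shift [l] by a constant. *)
rewrite -exprMn in hN.
pose d z : 'rV[C]_3 := \row_p (z * w ^+ p).
have toD (A W : 'M[C]_3) z : (forall m k, (W *m A) m k = z * w ^+ m * W m k) ->
    W *m A = diag_mx (d z) *m W.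
  by move=> h; apply/matrixP => p q; rewrite h mul_diag_mx !mxE.
have [WY [uY /toD eY]] := clock_diag w1 hY.
have [WM [uM /toD eM]] := clock_diag w1 hM.
have [WN [uN /toD eN]] := clock_diag w1 hN.
pose U' := (WY *t WM) *m U *m (1%:M *t adjmx WN).
exists U'.
  by exists WY, WM, 1%:M, (adjmx WN); split=> //; [exact: unitary1|exact: unitary_adj].
have hU : unitarymx U by case: tU.
have NYM' : U *m (1%:M *t N) = (Y *t M) *m U.
  by rewrite -NYM -!mulmxA unitary_mulV // mulmx1.
have eN' : N *m adjmx WN = adjmx WN *m diag_mx (d (y * m)).
  rewrite -[N]mul1mx -(unitary_mulV uN) -!mulmxA; congr (_ *m _).
  by rewrite mulmxA eN -mulmxA uN mulmx1.
have key : U' *m (diag_mx (const_mx 1) *t diag_mx (d (y * m))) = (diag_mx (d y) *t diag_mx (d m)) *m U'.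
  rewrite diag_const_mx /U' -!mulmxA tensmx_mul mul1mx -eN'.
  have -> : (1%:M : 'M_3) *t (N *m adjmx WN) = (1%:M *t N) *m (1%:M *t adjmx WN).
    by rewrite tensmx_mul mulmx1.
  by rewrite !mulmxA -(mulmxA _ U) NYM' !mulmxA !tensmx_mul eY eM.
move=> i j k l U0; have := congr1 (fun A : 'M_(3 * 3) => A (pidx i j) (pidx k l)) key.
rewrite /= mul_diag_tens diag_tens_mul [const_mx _ _ _]mxE ![d _ _ _]mxE mul1r.
rewrite [LHS]mulrC => /(mulIf U0) e.
apply: (omega_inj w1); rewrite /= (omega_mod w1) exprD.
have ym0 : y * m != 0.
  by case: hN => + _ _ _ _; rewrite expf_eq0.
by apply: (mulfI ym0); rewrite e; ring.
Qed.

(** * Orthogonality relations on the support [l = i + j] *)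

Section Support.
Variable U : 'M[C]_(3 * 3).
Hypothesis tU : two_unitary U.
Hypothesis supp : forall i j k l, U (pidx i j) (pidx k l) != 0 -> l = i + j.

(** With [l] determined by [i] and [j], the matrix amounts to nine vectors [b i j] in dimension
    3. *)
Let b i j k := U (pidx i j) (pidx k (i + j)).

Lemma supp0 i j k l : l != i + j -> U (pidx i j) (pidx k l) = 0.
Proof. by move=> ne; apply: contraNeq ne => /supp ->. Qed.

(** In [sum23] at [l = i + j] and [l' = i' + j], the support leaves a single value of the summed
    index of leg 2. The next two lemmas restrict [sum13] and [sum34] in the same way. *)
Lemma dot_same_col i i' j : \sum_k b i j k * (b i' j k)^* = (i == i')%:R.
Proof.
have := sum23 (perfect_mxtensor tU) i (i + j) i' (i' + j).
rewrite (inj_eq (addIr _)) (bigD1 j) //= [X in _ + X]big1 => [|j' ne].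
  by rewrite addr0 => -> ; case: (i == i'); rewrite ?mulr1 ?mulr0.
rewrite big1 // => k _; rewrite /mxtensor supp0 ?mul0r //.
by rewrite (inj_eq (addrI _)) eq_sym.
Qed.

Lemma dot_same_row i j j' : \sum_k b i j k * (b i j' k)^* = (j == j')%:R.
Proof.
have := sum13 (perfect_mxtensor tU) j (i + j) j' (i + j').
rewrite (inj_eq (addrI _)) (bigD1 i) //= [X in _ + X]big1 => [|i' ne].
  by rewrite addr0 => -> ; case: (j == j'); rewrite ?mulr1 ?mulr0.
rewrite big1 // => k _; rewrite /mxtensor supp0 ?mul0r //.
by rewrite (inj_eq (addIr _)) eq_sym.
Qed.

Lemma dot_same_sum i j i' j' : i + j = i' + j' ->
  \sum_k b i j k * (b i' j' k)^* = (i == i')%:R * (j == j')%:R.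
Proof.
move=> e; have := sum34 (perfect_mxtensor tU) i j i' j'.
rewrite exchange_big (bigD1 (i + j)) //= [X in _ + X]big1 => [|l ne].
  by rewrite addr0 /b -e.
by rewrite big1 // => k _; rewrite /mxtensor supp0 ?mul0r.
Qed.

Lemma zmod3_cases (i j k : I) : j != 0 -> k != i - j -> k = i \/ k = i + j.
Proof.
case: i => -[|[|[|//]]] ?; case: j => -[|[|[|//]]] ?; case: k => -[|[|[|//]]] ? //= _ _;
  by [left; apply: val_inj | right; apply: val_inj].
Qed.

(* The columns at [(i, j)] are multiples of those at [(i - j, 0)]: they are
   orthogonal to the columns at [(i, 0)] (same row) and [(i + j, 0)] (same sum). *)
Lemma latin_support : exists2 U', LU_equiv_mx U U' &
  exists2 t : I -> I -> C, (forall i j, `|t i j| = 1) &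
    forall i j k l, U' (pidx i j) (pidx k l) = ((k == i - j) && (l == i + j))%:R * t i j.
Proof.
(* The rows of [G] are the orthonormal vectors [b m 0]; in this basis of leg 3 the entries of [U']
   are inner products with them. *)
pose G := \matrix_(m < 3, k < 3) b m 0 k.
have uG : unitarymx G.
  apply/matrixP => m n; rewrite !mxE -(dot_same_col m n 0).
  by apply: eq_bigr => k _; rewrite adjmxE !mxE.
pose U' := (1%:M *t 1%:M) *m U *m (adjmx G *t 1%:M).
have LU : LU_equiv_mx U U'.
  exists 1%:M, 1%:M, (adjmx G), 1%:M.
  by split=> //; try exact: unitary1; exact: unitary_adj.
have U'E i j k l : U' (pidx i j) (pidx k l) =
    \sum_k' U (pidx i j) (pidx k' l) * (b k 0 k')^*.
  rewrite /U' tens1mx1 mul1mx mxE sum_tens; apply: eq_bigr => k' _.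
  rewrite (bigD1 l) //= big1 => [|l' ne].
    by rewrite addr0 tensmxE adjmxE !mxE eqxx mulr1.
  by rewrite tensmxE !mxE (negPf ne) !mulr0.
have z i j k l : ~~ ((k == i - j) && (l == i + j)) -> U' (pidx i j) (pidx k l) = 0.
  rewrite U'E; case: (eqVneq l (i + j)) => [->|ne _]; last first.
    by rewrite big1 // => k' _; rewrite supp0 ?mul0r.
  rewrite andbT; case: (eqVneq j 0) => [->|j0] ne.
    by rewrite dot_same_col eq_sym; move: ne; rewrite subr0 => /negPf ->.
  case: (zmod3_cases j0 ne) => ->.
    by rewrite dot_same_row (negPf j0).
  by rewrite dot_same_sum ?addr0 // (negPf j0) mulr0.
have [uU' _ _] := two_unitary_LU LU tU.
exists U' => //; exists (fun i j => U' (pidx i j) (pidx (i - j) (i + j))) => [i j|i j k l]; last first.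
  case: (boolP (_ && _)) => [/andP[/eqP -> /eqP ->]|/z ->]; first by rewrite mul1r.
  by rewrite mul0r.
have := unitary_rows uU' i j i j; rewrite !eqxx mulr1.
rewrite (bigD1 (i - j)) //= [X in _ + X]big1 => [|k ne]; last first.
  by rewrite big1 // => l _; rewrite z ?mul0r // (negPf ne).
rewrite addr0 (bigD1 (i + j)) //= big1 => [|l ne]; last first.
  by rewrite z ?mul0r // (negPf ne) andbF.
rewrite addr0 -normCK => /eqP; rewrite pexpr_eq1 // => /eqP //.
Qed.

End Support.

(** Indicator of the words [(i, j, i - j, i + j)] of the tetracode, the self-dual ternary code of
    length 4, dimension 2 and distance 3: any two coordinates determine the other two. *)
Definition tetracode_mx : 'M[C]_(3 * 3) := \matrix_(r, c)
  (((u c).1 == (u r).1 - (u r).2) && ((u c).2 == (u r).1 + (u r).2))%:R.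

Lemma tetracode_mxE i j k l : tetracode_mx (pidx i j) (pidx k l) = ((k == i - j) && (l == i + j))%:R.
Proof. by rewrite mxE !mxtens_indexK. Qed.

(* Every point other than [(i, j)] lies on exactly one of the four lines through
   [(i, j)] considered here. *)
Lemma prod_lines (f : I -> I -> C) i j :
  (\prod_j' f i j') * (\prod_i' f i' j) * (\prod_j' f (i - j + j') j')
    * (\prod_j' f (i + j - j') j') = f i j ^+ 3 * \prod_i' \prod_j' f i' j'.
Proof.
pose x p q := f (inord p) (inord q).
have fE p q : f p q = x p q by rewrite /x !inord_val.
under [X in X * _ * _ * _]eq_bigr do rewrite fE.
under [X in _ * X * _ * _]eq_bigr do rewrite fE.
under [X in _ * _ * X * _]eq_bigr do rewrite fE.
under [X in _ * _ * _ * X]eq_bigr do rewrite fE.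
under [X in _ = _ * X]eq_bigr do under eq_bigr do rewrite fE.
rewrite fE !big_ord_recl !big_ord0; clearbody x.
case: i => -[|[|[|//]]] ?; case: j => -[|[|[|//]]] ?; rewrite /=;
repeat match goal with |- context [x ?p ?q] =>
  let p' := eval vm_compute in p in let q' := eval vm_compute in q in
  progress change (x p q) with (x p' q') end; ring.
Qed.

Lemma unitary_diag (a : I -> C) : (forall i, `|a i| = 1) -> unitarymx (diag_mx (\row_i a i)).
Proof.
move=> a1; apply/matrixP => i j; rewrite mul_diag_mx mxE adjmxE !mxE (eq_sym j).
case: eqVneq => [->|_]; last by rewrite !mulr0n rmorph0 mulr0.
by rewrite !mulr1n -normCK a1 expr1n.
Qed.

Lemma LU_tetracode (U : 'M[C]_(3 * 3)) : two_unitary U -> LU_equiv_mx U tetracode_mx.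
Proof.
move=> tU; have [U1 LU1 supp] := shift_support tU.
have tU1 := two_unitary_LU LU1 tU.
have [U2 LU2 [t t1 U2E]] := latin_support tU1 supp.
apply: LU_trans LU1 (LU_trans LU2 _).
(* In [prod_lines] the phase at [(i, j)] appears to the power 3, so the identity is applied to cube
   roots of the phases. *)
pose f i j := 3.-root (t i j).
have f3 i j : f i j ^+ 3 = t i j by rewrite rootCK.
have f1 i j : `|f i j| = 1.
  have := t1 i j; rewrite -f3 normrX => /eqP.
  by rewrite pexpr_eq1 ?normr_ge0 // => /eqP.
have p1 (F : I -> C) : (forall i, `|F i| = 1) -> `|\prod_i F i| = 1.
  by move=> F1; rewrite normr_prod big1.
have f0 i j : f i j != 0 by rewrite -normr_eq0 f1 oner_eq0.
(* The inverses of the four line products of [prod_lines], read as functions of [i], [j],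
   [k = i - j] and [l = i + j]; the constant total product is put into [a]. *)
pose a i := (\prod_j' f i j')^-1 * \prod_i' \prod_j' f i' j'.
pose b j := (\prod_i' f i' j)^-1.
pose c k := (\prod_j' f (k + j') j')^-1.
pose d l := (\prod_j' f (l - j') j')^-1.
exists (diag_mx (\row_i a i)), (diag_mx (\row_i b i)), (diag_mx (\row_i c i)), (diag_mx (\row_i d i)).
split; try (apply: unitary_diag => i).
- by rewrite /a normrM normfV !p1 ?invr1 ?mulr1 // => ?; rewrite p1.
- by rewrite /b normfV p1 ?invr1.
- by rewrite /c normfV p1 ?invr1.
- by rewrite /d normfV p1 ?invr1.
apply/matrixP => r s; case: (mxtens_indexP r) => i j; case: (mxtens_indexP s) => k l.
rewrite -/(pidx i j) -/(pidx k l) mul_diag_tens diag_tens_mul tetracode_mxE U2E ![(\row__ _) _ _]mxE.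
case: (boolP (_ && _)) => [/andP[/eqP -> /eqP ->]|_]; last by rewrite mul0r mulr0 mul0r.
have pl := prod_lines f i j.
have n0 (F : I -> C) : (forall i, F i != 0) -> \prod_i F i != 0 by move=> F0; apply/prodf_neq0.
have h1 := n0 (fun j' => f i j') (fun=> f0 _ _).
have h2 := n0 (fun i' => f i' j) (fun=> f0 _ _).
have h3 := n0 (fun j' => f (i - j + j') j') (fun=> f0 _ _).
have h4 := n0 (fun j' => f (i + j - j') j') (fun=> f0 _ _).
rewrite -f3 /a /b /c /d; apply: (mulfI h1); apply: (mulfI h2); apply: (mulfI h3); apply: (mulfI h4).
move: h1 h2 h3 h4 pl; set A := \prod_j' f i j'; set B := \prod_i' f i' j.
set D := \prod_j' f (i - j + j') j'; set E := \prod_j' f (i + j - j') j'; set P := \prod_i' _.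
move=> h1 h2 h3 h4 pl; rewrite mul1r mulr1.
transitivity (f i j ^+ 3 * P); last by field; rewrite h1 h2 h3 h4.
by rewrite -pl; ring.
Qed.

Lemma unitary_perm (s : I -> I -> I * I) (M : 'M[C]_(3 * 3)) :
  (forall a b c d, M (pidx a b) (pidx c d) = ((c == (s a b).1) && (d == (s a b).2))%:R) ->
  (forall a b a' b', s a b = s a' b' -> a = a' /\ b = b') -> unitarymx M.
Proof.
move=> ME s_inj; apply: unitary_of_rows => a b a' b'.
transitivity (\sum_c \sum_d (c == (s a b).1)%:R * ((d == (s a b).2)%:R *
    (((s a b).1 == (s a' b').1) && ((s a b).2 == (s a' b').2))%:R) : C).
  apply: eq_bigr => c _; apply: eq_bigr => d _; rewrite !ME conjC_nat.
  by case: eqVneq => [->|]; case: eqVneq => [->|]; rewrite /= ?mul0r ?mul1r.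
under eq_bigr do rewrite -mulr_sumr sum_delta.
rewrite sum_delta -natrM mulnb; congr (nat_of_bool _)%:R.
rewrite -xpair_eqE -!surjective_pairing -xpair_eqE.
by apply/eqP/eqP => [/s_inj[-> ->]|[-> ->]].
Qed.

Lemma two_unitary_tetracode : two_unitary tetracode_mx.
Proof.
split.
- apply: (@unitary_perm (fun a b => (a - b, a + b))) => [a b c d|a b a' b' [e1 e2]].
    exact: tetracode_mxE.
  by move: e1 e2; case: a => -[|[|[|//]]] ?; case: b => -[|[|[|//]]] ?;
    case: a' => -[|[|[|//]]] ?; case: b' => -[|[|[|//]]] ? //= _ _; split; apply: val_inj.
(* The column [(c, d)] solves [b = a - c] and [d = a + c]. *)
- apply: (@unitary_perm (fun a b => (a - b, a + a - b))) => [a b c d|a b a' b' [e1 e2]].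
    rewrite realignE tetracode_mxE.
    by case: a => -[|[|[|//]]] ?; case: b => -[|[|[|//]]] ?;
      case: c => -[|[|[|//]]] ?; case: d => -[|[|[|//]]] ?.
  by move: e1 e2; case: a => -[|[|[|//]]] ?; case: b => -[|[|[|//]]] ?;
    case: a' => -[|[|[|//]]] ?; case: b' => -[|[|[|//]]] ? //= _ _; split; apply: val_inj.
(* Here it solves [c = a - d] and [b = a + d]. *)
- apply: (@unitary_perm (fun a b => (a + a - b, b - a))) => [a b c d|a b a' b' [e1 e2]].
    rewrite ptransE tetracode_mxE.
    by case: a => -[|[|[|//]]] ?; case: b => -[|[|[|//]]] ?;
      case: c => -[|[|[|//]]] ?; case: d => -[|[|[|//]]] ?.
  by move: e1 e2; case: a => -[|[|[|//]]] ?; case: b => -[|[|[|//]]] ?;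
    case: a' => -[|[|[|//]]] ?; case: b' => -[|[|[|//]]] ? //= _ _; split; apply: val_inj.
Qed.

End Canonical.

(** * States *)

Section States.
Variable C : numClosedFieldType.
Local Notation unitarymx := (@Defs.unitarymx C _).
Local Notation I := 'I_3.
Local Notation o m := (inord m : 'I_4).

Definition mkcfg (i j k l : I) : cfg 3 := [ffun m : 'I_4 => nth i [:: i; j; k; l] m].

Lemma mkcfg0 i j k l : mkcfg i j k l (o 0) = i. Proof. by rewrite ffunE inordK. Qed.
Lemma mkcfg1 i j k l : mkcfg i j k l (o 1) = j. Proof. by rewrite ffunE inordK. Qed.
Lemma mkcfg2 i j k l : mkcfg i j k l (o 2) = k. Proof. by rewrite ffunE inordK. Qed.
Lemma mkcfg3 i j k l : mkcfg i j k l (o 3) = l. Proof. by rewrite ffunE inordK. Qed.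
Definition mkcfgE := (mkcfg0, mkcfg1, mkcfg2, mkcfg3).

Lemma cfgP (x y : cfg 3) : x (o 0) = y (o 0) -> x (o 1) = y (o 1) ->
  x (o 2) = y (o 2) -> x (o 3) = y (o 3) -> x = y.
Proof.
move=> h0 h1 h2 h3; apply/ffunP => m; rewrite -(inord_val m).
by case: m => -[|[|[|[|//]]]].
Qed.

Lemma cfg_eta (x : cfg 3) : x = mkcfg (x (o 0)) (x (o 1)) (x (o 2)) (x (o 3)).
Proof. by apply: cfgP; rewrite mkcfgE. Qed.

Lemma sum_cfg (F : cfg 3 -> C) :
  \sum_z F z = \sum_i \sum_j \sum_k \sum_l F (mkcfg i j k l).
Proof.
pose h (t : I * (I * (I * I))) := mkcfg t.1 t.2.1 t.2.2.1 t.2.2.2.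
rewrite (reindex h) /=.
  rewrite sum_pair; apply: eq_bigr => i _; rewrite sum_pair; apply: eq_bigr => j _.
  by rewrite sum_pair.
exists (fun x : cfg 3 => (x (o 0), (x (o 1), (x (o 2), x (o 3))))) => [[i [j [k l]]] _|x _].
  by rewrite /h /= !mkcfgE.
by rewrite /h /= -cfg_eta.
Qed.

Lemma inordI (m n : nat) : (m < 4)%N -> (n < 4)%N -> ((o m) == (o n)) = (m == n).
Proof. by move=> hm hn; rewrite -val_eqE /= !inordK. Qed.

Lemma forall_pair (p q : 'I_4) (P : pred 'I_4) :
  [forall k in [set p; q], P k] = P p && P q.
Proof.
apply/forall_inP/andP => [e|[e1 e2] k]; first by rewrite !e // !inE eqxx ?orbT.
by rewrite !inE => /orP[]/eqP ->.
Qed.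

(** [h] parametrizes the configurations agreeing with [x] on [p] and [q] by their values at the
    other parties [r] and [s]; this serves all six pairs at once. *)
Lemma rdm_pair (psi : cfg 3 -> C) p q r s (x y : cfg 3) (h hy : I -> I -> cfg 3) :
  (forall z : cfg 3, z p = x p -> z q = x q -> h (z r) (z s) = z) ->
  (forall a b, [/\ h a b p = x p, h a b q = x q, h a b r = a & h a b s = b]) ->
  (forall a b, glue [set p; q] y (h a b) = hy a b) ->
  rdm psi [set p; q] x y = \sum_a \sum_b psi (h a b) * (psi (hy a b))^*.
Proof.
move=> hz hE hyE.
rewrite /rdm (reindex_onto (fun ab => h ab.1 ab.2) (fun z => (z r, z s))) /=; last first.
  by move=> z; rewrite forall_pair => /andP[/eqP e1 /eqP e2]; apply: hz.
rewrite (eq_bigl xpredT) => [|[a b]]; last first.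
  by rewrite forall_pair /=; have [-> -> -> ->] := hE a b; rewrite !eqxx.
by rewrite sum_pair; do 2 (apply: eq_bigr => ? _); rewrite hyE.
Qed.

Lemma glueE (S : {set 'I_4}) (y z : cfg 3) k : glue S y z k = if k \in S then y k else z k.
Proof. by rewrite ffunE. Qed.

Section Pairs.
Variables (psi : cfg 3 -> C) (x y : cfg 3).

Lemma rdm01 : rdm psi [set o 0; o 1] x y = \sum_a \sum_b
  psi (mkcfg (x (o 0)) (x (o 1)) a b) * (psi (mkcfg (y (o 0)) (y (o 1)) a b))^*.
Proof.
apply: (@rdm_pair _ _ _ (o 2) (o 3)) => [z e1 e2|a b|a b].
- by apply: cfgP; rewrite ?mkcfgE ?e1 ?e2.
- by rewrite !mkcfgE.
- by apply: cfgP; rewrite glueE !inE !inordI //= !mkcfgE.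
Qed.
Lemma rdm02 : rdm psi [set o 0; o 2] x y = \sum_a \sum_b
  psi (mkcfg (x (o 0)) a (x (o 2)) b) * (psi (mkcfg (y (o 0)) a (y (o 2)) b))^*.
Proof.
apply: (@rdm_pair _ _ _ (o 1) (o 3)) => [z e1 e2|a b|a b].
- by apply: cfgP; rewrite ?mkcfgE ?e1 ?e2.
- by rewrite !mkcfgE.
- by apply: cfgP; rewrite glueE !inE !inordI //= !mkcfgE.
Qed.
Lemma rdm03 : rdm psi [set o 0; o 3] x y = \sum_a \sum_b
  psi (mkcfg (x (o 0)) a b (x (o 3))) * (psi (mkcfg (y (o 0)) a b (y (o 3))))^*.
Proof.
apply: (@rdm_pair _ _ _ (o 1) (o 2)) => [z e1 e2|a b|a b].
- by apply: cfgP; rewrite ?mkcfgE ?e1 ?e2.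
- by rewrite !mkcfgE.
- by apply: cfgP; rewrite glueE !inE !inordI //= !mkcfgE.
Qed.
Lemma rdm12 : rdm psi [set o 1; o 2] x y = \sum_a \sum_b
  psi (mkcfg a (x (o 1)) (x (o 2)) b) * (psi (mkcfg a (y (o 1)) (y (o 2)) b))^*.
Proof.
apply: (@rdm_pair _ _ _ (o 0) (o 3)) => [z e1 e2|a b|a b].
- by apply: cfgP; rewrite ?mkcfgE ?e1 ?e2.
- by rewrite !mkcfgE.
- by apply: cfgP; rewrite glueE !inE !inordI //= !mkcfgE.
Qed.
Lemma rdm13 : rdm psi [set o 1; o 3] x y = \sum_a \sum_b
  psi (mkcfg a (x (o 1)) b (x (o 3))) * (psi (mkcfg a (y (o 1)) b (y (o 3))))^*.
Proof.
apply: (@rdm_pair _ _ _ (o 0) (o 2)) => [z e1 e2|a b|a b].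
- by apply: cfgP; rewrite ?mkcfgE ?e1 ?e2.
- by rewrite !mkcfgE.
- by apply: cfgP; rewrite glueE !inE !inordI //= !mkcfgE.
Qed.
Lemma rdm23 : rdm psi [set o 2; o 3] x y = \sum_a \sum_b
  psi (mkcfg a b (x (o 2)) (x (o 3))) * (psi (mkcfg a b (y (o 2)) (y (o 3))))^*.
Proof.
apply: (@rdm_pair _ _ _ (o 0) (o 1)) => [z e1 e2|a b|a b].
- by apply: cfgP; rewrite ?mkcfgE ?e1 ?e2.
- by rewrite !mkcfgE.
- by apply: cfgP; rewrite glueE !inE !inordI //= !mkcfgE.
Qed.
End Pairs.

(** Inverse of the passage from a matrix to its state: the factor 3 undoes the normalization
    [1/d]. *)
Definition state_mx (psi : cfg 3 -> C) : 'M[C]_(3 * 3) := \matrix_(r, c)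
  (3%:R * psi (mkcfg (unpidx r).1 (unpidx r).2 (unpidx c).1 (unpidx c).2)).

Lemma state_mxE psi i j k l : state_mx psi (pidx i j) (pidx k l) = 3%:R * psi (mkcfg i j k l).
Proof. by rewrite mxE /unpidx !mxtens_indexK. Qed.

(** The reductions to parties [0, 1], to [0, 2] and to [0, 3] are the Gram matrices of the rows of
    the matrix, its realignment and its partial transpose, up to the factor 9. *)
Lemma two_unitary_state psi : AME4 psi -> two_unitary (state_mx psi).
Proof.
move=> hpsi; have card2 m n : (m < 4)%N -> (n < 4)%N -> m != n -> #|[set o m; o n]| = 2.
  by move=> hm hn mn; rewrite cards2 inordI // mn.
have c9 (a b : C) : (3%:R * a) * (3%:R * b)^* = (3%:R ^+ 2) * (a * b^*).
  by rewrite rmorphM /= conjC_nat; ring.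
have n9 : (3%:R ^+ 2 : C) != 0 by rewrite expf_neq0 // pnatr_eq0.
have fin (b1 b2 : bool) : 3%:R ^+ 2 * (if b1 && b2 then (3%:R ^+ 2)^-1 else 0) = b1%:R * b2%:R :> C.
  by case: b1; case: b2; rewrite /= ?mulfV // ?mulr0 ?mul0r ?mulr1.
split; apply: unitary_of_rows => a b a' b'.
- have := hpsi [set o 0; o 1]; rewrite card2 // => /(_ isT).
  move=> /(_ (mkcfg a b 0 0) (mkcfg a' b' 0 0)); rewrite rdm01 forall_pair card2 // !mkcfgE => e.
  rewrite -fin -e mulr_sumr;
  apply: eq_bigr => c _; rewrite mulr_sumr; apply: eq_bigr => d _.
  by rewrite !state_mxE c9.
- have := hpsi [set o 0; o 2]; rewrite card2 // => /(_ isT).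
  move=> /(_ (mkcfg a 0 b 0) (mkcfg a' 0 b' 0)); rewrite rdm02 forall_pair card2 // !mkcfgE => e.
  rewrite -fin -e mulr_sumr;
  apply: eq_bigr => c _; rewrite mulr_sumr; apply: eq_bigr => d _.
  by rewrite !realignE !state_mxE c9.
- have := hpsi [set o 0; o 3]; rewrite card2 // => /(_ isT).
  move=> /(_ (mkcfg a 0 0 b) (mkcfg a' 0 0 b')); rewrite rdm03 forall_pair card2 // !mkcfgE => e.
  rewrite -fin -e exchange_big mulr_sumr;
  apply: eq_bigr => c _; rewrite mulr_sumr; apply: eq_bigr => d _.
  by rewrite !ptransE !state_mxE c9.
Qed.

Definition upd (x : cfg 3) k v : cfg 3 := [ffun m => if m == k then v else x m].

(** Tracing out party [k] adds 3 equal terms, which cancels one factor 3 of the weight. *)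
Lemma max_mixed_sub (psi : cfg 3 -> C) (S : {set 'I_4}) k :
  k \notin S -> max_mixed psi (k |: S) -> max_mixed psi S.
Proof.
move=> kS hS x y.
have inS m : m \in S -> (m == k) = false.
  by move=> mS; apply: contraNF kS => /eqP <-.
have fU (P Q : pred 'I_4) : {in S, P =1 Q} ->
    [forall m in k |: S, P m] = [forall m in S, Q m] && P k.
  move=> PQ; apply/forall_inP/andP => [e|[/forall_inP e1 e2] m].
    split; last by apply: e; rewrite setU11.
    by apply/forall_inP => m mS; rewrite -PQ // e // setU1r.
  by rewrite in_setU1 => /predU1P[-> //|mS]; rewrite PQ // e1.
transitivity (\sum_v rdm psi (k |: S) (upd x k v) (upd y k v)).
  rewrite /rdm (partition_big (fun z : cfg 3 => z k) xpredT) //=; apply: eq_bigr => v _.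
  apply: eq_big => [z|z /andP[_ /eqP zk]].
    by rewrite (fU _ (fun m => z m == x m)) => [|m mS]; rewrite ffunE ?eqxx // inS.
  congr (_ * (psi _)^*); apply/ffunP => m; rewrite !ffunE in_setU1.
  by case: eqVneq => [->|] //=; rewrite (negPf kS).
under eq_bigr do rewrite hS.
under eq_bigr => v _.
  rewrite (fU _ (fun m => x m == y m)) => [|m mS]; last by rewrite !ffunE inS.
  rewrite !ffunE eqxx eqxx andbT cardsU1 kS; over.
rewrite sumr_const card_ord; case: ifP => _; last by rewrite mul0rn.
by rewrite add1n exprS invfM -mulrnAl -[_^-1 *+ 3]mulr_natr mulVf ?mul1r ?pnatr_eq0.
Qed.

(** Induction on the number of parties that [S] lacks to be a pair, down to the empty set, which is
    the normalization. *)
Lemma max_mixed_AME (psi : cfg 3 -> C) :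
  (forall p q, p != q -> max_mixed psi [set p; q]) -> AME4 psi.
Proof.
move=> h S; move: {2}(2 - #|S|)%N (erefl (2 - #|S|)%N) => n.
elim: n S => [|n IHn] S nE le2.
  have /cards2P[p [q [pq ->]]] : #|S| == 2 by rewrite eqn_leq le2 -subn_eq0 nE.
  exact: h.
have [k kS] : exists k, k \notin S.
  apply/existsP; rewrite -[X in is_true X]negbK negb_exists; apply/negP => /forallP all.
  have : #|S| = 4 by rewrite -[RHS](card_ord 4); apply: eq_card => m; rewrite (negbNE (all m)).
  by move=> e; rewrite e in le2.
apply: (max_mixed_sub kS); apply: IHn; rewrite cardsU1 kS add1n.
  by rewrite subnS nE.
by rewrite ltn_neqAle le2 andbT; apply: contra_eq_neq nE => ->.
Qed.

Definition tetracode_state (x : cfg 3) : C :=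
  tetracode_mx C (pidx (x (o 0)) (x (o 1))) (pidx (x (o 2)) (x (o 3))) / 3%:R.

Lemma AME_tetracode : AME4 tetracode_state.
Proof.
have hP := perfect_mxtensor (two_unitary_tetracode C).
have c9 (a b : C) : (a / 3%:R) * (b / 3%:R)^* = (3%:R ^+ 2)^-1 * (a * b^*).
  by rewrite rmorphM fmorphV /= conjC_nat expr2 invfM; ring.
have fin (b1 b2 : bool) : (3%:R ^+ 2)^-1 * (b1%:R * b2%:R) =
    (if b1 && b2 then (3%:R ^+ 2)^-1 else 0) :> C.
  by case: b1; case: b2; rewrite /= !(mulr0, mulr1).
have card2 m n : (m < 4)%N -> (n < 4)%N -> m != n -> #|[set o m; o n]| = 2.
  by move=> hm hn mn; rewrite cards2 inordI // mn.
have M01 : max_mixed tetracode_state [set o 0; o 1].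
  move=> x y; rewrite rdm01 forall_pair card2 // -fin -(sum34 hP) mulr_sumr.
  by apply: eq_bigr => a _; rewrite mulr_sumr;
    apply: eq_bigr => b _; rewrite /tetracode_state !mkcfgE c9.
have M02 : max_mixed tetracode_state [set o 0; o 2].
  move=> x y; rewrite rdm02 forall_pair card2 // -fin -(sum24 hP) mulr_sumr.
  by apply: eq_bigr => a _; rewrite mulr_sumr;
    apply: eq_bigr => b _; rewrite /tetracode_state !mkcfgE c9.
have M03 : max_mixed tetracode_state [set o 0; o 3].
  move=> x y; rewrite rdm03 forall_pair card2 // -fin -(sum23 hP) mulr_sumr.
  by apply: eq_bigr => a _; rewrite mulr_sumr;
    apply: eq_bigr => b _; rewrite /tetracode_state !mkcfgE c9.
have M12 : max_mixed tetracode_state [set o 1; o 2].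
  move=> x y; rewrite rdm12 forall_pair card2 // -fin -(sum14 hP) mulr_sumr.
  by apply: eq_bigr => a _; rewrite mulr_sumr;
    apply: eq_bigr => b _; rewrite /tetracode_state !mkcfgE c9.
have M13 : max_mixed tetracode_state [set o 1; o 3].
  move=> x y; rewrite rdm13 forall_pair card2 // -fin -(sum13 hP) mulr_sumr.
  by apply: eq_bigr => a _; rewrite mulr_sumr;
    apply: eq_bigr => b _; rewrite /tetracode_state !mkcfgE c9.
have M23 : max_mixed tetracode_state [set o 2; o 3].
  move=> x y; rewrite rdm23 forall_pair card2 // -fin -(sum12 hP) mulr_sumr.
  by apply: eq_bigr => a _; rewrite mulr_sumr;
    apply: eq_bigr => b _; rewrite /tetracode_state !mkcfgE c9.
apply: max_mixed_AME => p q; rewrite -(inord_val p) -(inord_val q).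
by case: p => -[|[|[|[|//]]]] ?; case: q => -[|[|[|[|//]]]] ?; rewrite ?eqxx //= => _; rewrite // setUC.
Qed.

(** Factors to the right of the matrix act on its column indices, hence appear transposed as
    operators on parties 2 and 3. *)
Lemma LU_equiv_state_mx psi1 psi2 :
  LU_equiv_mx (state_mx psi1) (state_mx psi2) -> LU_equiv_state psi1 psi2.
Proof.
case=> [a [b [c [d [ha hb hc hd e]]]]].
exists (fun k : 'I_4 => nth 1%:M [:: a; b; c^T; d^T] k); split.
  by case=> -[|[|[|[|//]]]] ? /=; rewrite ?hd //; exact: unitary_tr.
move=> x; rewrite {1}(cfg_eta x); apply: (@mulfI _ 3%:R); first by rewrite pnatr_eq0.
rewrite -state_mxE e LU_entries sum_cfg mulr_sumr; apply: eq_bigr => i _.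
rewrite mulr_sumr; apply: eq_bigr => j _; rewrite mulr_sumr; apply: eq_bigr => k _.
rewrite mulr_sumr; apply: eq_bigr => l _; rewrite state_mxE.
rewrite (_ : \prod_(m < 4) _ = a (x (o 0)) i * b (x (o 1)) j * c k (x (o 2)) * d l (x (o 3))); first by ring.
pose F m := nth 1%:M [:: a; b; c^T; d^T] m (x (o m)) (mkcfg i j k l (o m)).
transitivity (\prod_(m < 4) F m); first by apply: eq_bigr => m _; rewrite /F inord_val.
by rewrite !big_ord_recl big_ord0 /F /= !mkcfgE !mxE; ring.
Qed.

End States.

Theorem theorem1 (R : realType) :
  [/\ (exists U : 'M[R[i]]_(3 * 3), two_unitary U),
      (forall U U' : 'M[R[i]]_(3 * 3),
          two_unitary U -> two_unitary U' -> LU_equiv_mx U U'),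
      (exists psi : cfg 3 -> R[i], AME4 psi) &
      (forall psi1 psi2 : cfg 3 -> R[i],
          AME4 psi1 -> AME4 psi2 -> LU_equiv_state psi1 psi2)].
Proof.
have uniq (U U' : 'M[R[i]]_(3 * 3)) : two_unitary U -> two_unitary U' -> LU_equiv_mx U U'.
  by move=> tU tU'; apply: LU_trans (LU_tetracode tU) (LU_sym (LU_tetracode tU')).
split=> //.
- by exists (tetracode_mx _); exact: two_unitary_tetracode.
- by exists (@tetracode_state _); exact: AME_tetracode.
- move=> psi1 psi2 h1 h2; apply: LU_equiv_state_mx; apply: uniq; exact: two_unitary_state.
Qed.
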